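(* Let $\omega:[0,+\infty)\to[0,+\infty)$ be a continuous function such that $\omega(\mu)>0$ for every $\mu>0$, $\int_1^{+\infty}\frac{\omega(\mu)}{\mu^2}\,d\mu=+\infty$, and $\liminf_{\mu\to+\infty}\omega(\mu)>0$. Let $d$ be a positive integer, let $\Omega\subseteq\mathbb{R}^d$ be a connected open set, and let $u\in L^{\infty}(\Omega)$ be a real-valued function that is not essentially constant. Then $\mathscr{F}_\omega(u,\Omega)=+\infty$.
   Context: For a measurable $u:\Omega\to\mathbb{R}$, $$\mathscr{F}_\omega(u,\Omega):=\iint_{\Omega\times\Omega}\omega\left(\frac{|u(y)-u(x)|}{|y-x|}\right)\frac{1}{|y-x|^d}\,dx\,dy\in[0,+\infty].$$ A measurable function is essentially constant if it coincides almost everywhere with a constant. *)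

(* Defs.v *)
From HB Require Import structures.
From mathcomp Require Import all_boot all_order all_algebra.
From mathcomp Require Import all_classical all_reals all_analysis.
From mathcomp Require Import lra.

Set Implicit Arguments.
Unset Strict Implicit.
Unset Printing Implicit Defensive.
Import Order.TTheory GRing.Theory Num.Theory.
Import numFieldNormedType.Exports.

Local Open Scope classical_set_scope.
Local Open Scope ring_scope.

Section lebesgue_outer_measure.
Context (R : realType) (d : nat).
Implicit Types (a b x : 'rV[R]_d) (A : set 'rV[R]_d).

(* The half-open box \prod_i ]a_i, b_i]. *)
Definition box a b : set 'rV[R]_d :=
  [set x | forall i, a ord0 i < x ord0 i <= b ord0 i].

Definition box_vol a b : R := \prod_(i < d) Num.max 0 (b ord0 i - a ord0 i).

(* [None] stands for the empty set, so that finite families of boxes are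
   allowed as covers; in dimension 0 there is no empty box to pad with. *)
Definition obox (I : option ('rV[R]_d * 'rV[R]_d)) : set 'rV[R]_d :=
  if I is Some (a, b) then box a b else set0.

Definition obox_vol (I : option ('rV[R]_d * 'rV[R]_d)) : \bar R :=
  if I is Some (a, b) then (box_vol a b)%:E else 0%E.

Definition box_cover A : set (nat -> option ('rV[R]_d * 'rV[R]_d)) :=
  [set I | A `<=` \bigcup_k obox (I k)].

Definition lebesgue_outer A : \bar R :=
  ereal_inf [set (\sum_(k <oo) obox_vol (I k))%E | I in box_cover A].

Lemma box_vol_ge0 a b : 0 <= box_vol a b.
Proof. by apply: prodr_ge0 => i _; rewrite le_max lexx. Qed.

Lemma obox_vol_ge0 I : (0 <= obox_vol I)%E.
Proof. by case: I => [[a b]|] //=; rewrite lee_fin box_vol_ge0. Qed.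

Lemma lebesgue_outer_ge0 A : (0 <= lebesgue_outer A)%E.
Proof.
apply: le_ereal_inf_tmp => _ [I _ <-].
by apply: nneseries_ge0 => *; exact: obox_vol_ge0.
Qed.

Lemma lebesgue_outer0 : lebesgue_outer set0 = 0%E.
Proof.
apply/eqP; rewrite eq_le lebesgue_outer_ge0 andbT.
apply: ereal_inf_lbound; exists (fun=> None) => //=.
by rewrite eseries0.
Qed.

Lemma le_lebesgue_outer :
  {homo lebesgue_outer : A B / A `<=` B >-> (A <= B)%E}.
Proof.
move=> A B AB; apply/ereal_inf_le_tmp => _ [I IB <-].
by exists I => //; exact: subset_trans IB.
Qed.

Lemma lebesgue_outer_le2 A (G : nat -> nat -> option ('rV[R]_d * 'rV[R]_d)) :
  A `<=` \bigcup_n \bigcup_k obox (G n k) ->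
  (lebesgue_outer A <= \sum_(n <oo) \sum_(k <oo) obox_vol (G n k))%E.
Proof.
move=> AG.
have G0 z : (0 <= (obox_vol \o uncurry G) z)%E by exact: obox_vol_ge0.
apply: (@le_trans _ _ (\esum_(i in setT) (obox_vol \o uncurry G) i)%E).
  apply: ereal_inf_lbound => /=.
  have /card_esym/ppcard_eqP[f] := card_nat2.
  exists (uncurry G \o f).
    apply: (subset_trans AG) => t [i _ [j _ Gijt]].
    by exists (f^-1%FUN (i, j)) => //=; rewrite invK ?inE.
  rewrite -(esum_pred_image (obox_vol \o uncurry G) _ xpredT) ?[fun=> _]set_true//.
  by rewrite image_eq.
rewrite (_ : esum _ _ = \sum_(i <oo) \sum_(j <oo) obox_vol (G i j))%E //.
pose J : nat -> set (nat * nat) := fun i => [set (i, j) | j in setT].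
rewrite (_ : setT = \bigcup_k J k); last first.
  by rewrite predeqE => -[a b]; split => // _; exists a => //; exists b.
rewrite esum_bigcupT /=; last 2 first.
- apply/trivIsetP => i j _ _ ij.
  rewrite predeqE => -[n m] /=; split => //= -[] [_] _ [<-{n} _].
  by move=> [m' _] [] /esym/eqP; rewrite (negbTE ij).
- by move=> /= [n m]; exact: (G0 (n, m)).
rewrite -(image_id [set: nat]) -fun_true esum_pred_image//; last first.
  by move=> n _; apply: esum_ge0 => z _; exact: G0.
apply: eq_eseriesr => /= j _.
rewrite -(esum_pred_image (obox_vol \o uncurry G) (pair j) predT)//=; last first.
  by move=> ? ? _ _; exact: (@can_inj _ _ _ snd).
  by move=> n _; exact: obox_vol_ge0.
by congr esum; rewrite predeqE => -[a b]; split; move=> [i _ <-]; exists i.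
Qed.

Lemma lebesgue_outer_sigma_subadditive : sigma_subadditive lebesgue_outer.
Proof.
move=> A; have [[i ioo]|] := pselect (exists i, lebesgue_outer (A i) = +oo%E).
  rewrite (eseries_pinfty _ _ ioo) ?leey// => n _.
  by rewrite -ltNye (lt_le_trans _ (lebesgue_outer_ge0 _)).
rewrite -forallNE => Aoo.
suff add2e (e : {posnum R}) : (lebesgue_outer (\bigcup_n A n) <=
    \sum_(i <oo) lebesgue_outer (A i) + e%:num%:E)%E.
  by apply/lee_addgt0Pr => _/posnumP[].
rewrite (le_trans _ (epsilon_trick _ _ _))//; last first.
  by move=> n; exact: lebesgue_outer_ge0.
pose P n I := box_cover (A n) I /\ (\sum_(k <oo) obox_vol (I k) <=
  lebesgue_outer (A n) + (e%:num / (2 ^ n.+1)%:R)%:E)%E.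
have [G PG] : {G & forall n, P n (G n)}.
  apply: (@choice _ _ P) => n; rewrite /P.
  have en1 : (0 < e%:num / (2 ^ n.+1)%:R)%R by [].
  have fA : lebesgue_outer (A n) \is a fin_num.
    by rewrite ge0_fin_numE ?lebesgue_outer_ge0// ltey; exact/eqP/Aoo.
  have [_ [I AI <-] ltI] := lb_ereal_inf_adherent en1 fA.
  by exists I; split => //; exact/ltW.
apply: le_trans (lebesgue_outer_le2 (G := G) _) _.
  by move=> t [n _ Ant]; exists n => //; exact: (PG n).1.
apply: lee_nneseries => [n _ _|n _]; last exact: (PG n).2.
by apply: nneseries_ge0 => *; exact: obox_vol_ge0.
Qed.

HB.instance Definition _ := isOuterMeasure.Build R 'rV[R]_d lebesgue_outer
  lebesgue_outer0 lebesgue_outer_ge0 le_lebesgue_outer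
  lebesgue_outer_sigma_subadditive.

End lebesgue_outer_measure.

(* 'rV[R]_d carries the (complete) sigma-algebra of Lebesgue-measurable sets,
   that is, the Caratheodory-measurable sets of the Lebesgue outer measure. *)
HB.instance Definition _ (R : realType) (d : nat) :=
  Measurable.copy 'rV[R]_d (caratheodory_type (@lebesgue_outer R d)).

Definition lebesgue_rV (R : realType) (d : nat) : set 'rV[R]_d -> \bar R :=
  @lebesgue_outer R d.

Section lebesgue_rV_measure.
Context (R : realType) (d : nat).
Local Notation leb := (@lebesgue_rV R d).

Let lebesgue_rV0 : leb set0 = 0%E.
Proof. exact: lebesgue_outer0. Qed.

Let lebesgue_rV_ge0 A : (0 <= leb A)%E.
Proof. exact: lebesgue_outer_ge0. Qed.

Let lebesgue_rV_sigma_additive : semi_sigma_additive leb.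
Proof. exact: (@caratheodory_measure_sigma_additive R 'rV[R]_d). Qed.

HB.instance Definition _ := isMeasure.Build _ 'rV[R]_d R leb
  lebesgue_rV0 lebesgue_rV_ge0 lebesgue_rV_sigma_additive.

Lemma box_vol_split (a b : 'rV[R]_d) (i : 'I_d) (c : R) :
  box_vol a b =
  box_vol a (\row_j if j == i then Num.min (b ord0 j) c else b ord0 j) +
  box_vol (\row_j if j == i then Num.max (a ord0 j) c else a ord0 j) b.
Proof.
have E (v w : 'rV[R]_d) : box_vol v w = Num.max 0 (w ord0 i - v ord0 i) *
    \prod_(j < d | j != i) Num.max 0 (w ord0 j - v ord0 j).
  by rewrite /box_vol (bigD1 i).
rewrite !E !mxE eqxx.
rewrite [X in _ = _ * X + _](_ : _ = \prod_(j < d | j != i)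
  Num.max 0 (b ord0 j - a ord0 j)); last first.
  by apply: eq_bigr => j /negbTE ji; rewrite mxE ji.
rewrite [X in _ = _ + _ * X](_ : _ = \prod_(j < d | j != i)
  Num.max 0 (b ord0 j - a ord0 j)); last first.
  by apply: eq_bigr => j /negbTE ji; rewrite mxE ji.
rewrite -mulrDl; congr (_ * _).
by rewrite !maxEle !minEle; do !case: ifPn; lra.
Qed.

Lemma measurable_halfspace (i : 'I_d) (c : R) :
  measurable [set x : 'rV[R]_d | x ord0 i <= c].
Proof.
apply: le_caratheodory_measurable => X /=.
apply: le_ereal_inf_tmp => _ [I XI <-].
pose I1 k := if I k is Some (a, b) then
  Some (a, \row_j if j == i then Num.min (b ord0 j) c else b ord0 j) else None.
pose I2 k := if I k is Some (a, b) then
  Some (\row_j if j == i then Num.max (a ord0 j) c else a ord0 j, b) else None.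
have -> : (\sum_(k <oo) obox_vol (I k) =
    \sum_(k <oo) obox_vol (I1 k) + \sum_(k <oo) obox_vol (I2 k))%E.
  rewrite -nneseriesD; try by move=> *; exact: obox_vol_ge0.
  apply: eq_eseriesr => k _; rewrite /I1 /I2.
  by case: (I k) => [[a b]|] /=; rewrite ?adde0// (box_vol_split _ _ i c) EFinD.
apply: leeD; apply: ereal_inf_lbound.
- exists I1 => //= x [/XI[k _] Ix /= xc]; exists k => //; move: Ix.
  rewrite /I1; case: (I k) => [[a b]|] //= xab j; rewrite mxE.
  by have := xab j; case: eqP => // ->; rewrite le_min xc andbT.
- exists I2 => //= x [/XI[k _] Ix /negP]; rewrite -ltNge => xc.
  exists k => //; move: Ix.
  rewrite /I2; case: (I k) => [[a b]|] //= xab j; rewrite mxE.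
  by have := xab j; case: eqP => // ->; rewrite gt_max xc andbT.
Qed.

Lemma measurable_box (a b : 'rV[R]_d) : measurable (box a b).
Proof.
have -> : box a b = \bigcap_(i in [set: 'I_d])
    ([set x : 'rV[R]_d | x ord0 i <= b ord0 i] `\`
     [set x : 'rV[R]_d | x ord0 i <= a ord0 i]).
  apply/seteqP; split=> x /= xab i.
    by move=> _ /=; have /andP[] := xab i; rewrite ltNge => /negP.
  by have [/= -> /negP] := xab i I; rewrite -ltNge => ->.
apply: fin_bigcap_measurable; first exact: finite_finset.
by move=> i _; apply: measurableD; exact: measurable_halfspace.
Qed.

Lemma lebesgue_rV_box_le (a b : 'rV[R]_d) : (leb (box a b) <= (box_vol a b)%:E)%E.
Proof.
apply: ereal_inf_lbound.
exists (fun k => if (k == 0)%N then Some (a, b) else None) => /=.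
  by move=> x xab; exists 0%N.
rewrite (nneseries_split _ 1%N); last by move=> *; exact: obox_vol_ge0.
rewrite big_nat1 add0n eseries0 ?adde0// => k k1 _.
by rewrite gtn_eqF.
Qed.

Let lebesgue_rV_sigma_finite : sigma_finite setT leb.
Proof.
exists (fun n => box (const_mx (- n%:R)) (const_mx n%:R)).
  apply/esym; rewrite -subTset => x _.
  exists (\sum_(i < d) (Num.truncn `|x ord0 i|).+1)%N => //= i; rewrite !mxE.
  set n := (\sum_(_ < _) _)%N.
  have xn : `|x ord0 i| < n%:R.
    apply: lt_le_trans (truncnS_gt _) _.
    by rewrite ler_nat /n (bigD1 i)//= leq_addr.
  by move: xn; rewrite ltr_norml => /andP[-> /ltW].
move=> n; split; first exact: measurable_box.
by rewrite (le_lt_trans (lebesgue_rV_box_le _ _))// ltry.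
Qed.

HB.instance Definition _ := @Measure_isSigmaFinite.Build _ 'rV[R]_d R leb
  lebesgue_rV_sigma_finite.

End lebesgue_rV_measure.

(* The norm the library puts on 'rV[R]_d is the sup norm. *)
Definition euclid_norm (R : realType) (d : nat) (x : 'rV[R]_d) : R :=
  Num.sqrt (\sum_(i < d) x ord0 i ^+ 2).

Section functional.
Context (R : realType) (d : nat).
Local Notation leb := (@lebesgue_rV R d).
Implicit Types (Omega : set 'rV[R]_d) (u : 'rV[R]_d -> R) (omega : R -> R).

Definition Linfty Omega u : Prop :=
  measurable_fun Omega u /\
  exists M : R, {ae leb, forall x, Omega x -> `|u x| <= M}.

Definition essentially_constant Omega u : Prop :=
  exists c : R, {ae leb, forall x, Omega x -> u x = c}.

(* On the diagonal, which is a null set for d > 0, division by zero makes the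
   integrand 0. *)
Definition F_functional omega u Omega : \bar R :=
  (\int[leb \x leb]_(z in Omega `*` Omega)
     (omega (`|u z.2 - u z.1| / euclid_norm (z.2 - z.1))
        * (euclid_norm (z.2 - z.1) ^+ d)^-1)%:E)%E.

End functional.

(* Main.v *)
Require Import Defs.
From HB Require Import structures.
From mathcomp Require Import all_boot all_order all_algebra.
From mathcomp Require Import all_classical all_reals all_analysis.
From mathcomp Require Import measurable_realfun.
From mathcomp Require Import lra ring.

(** The functional controls [u] through lines. Suppose that it is finite; the claim is
that [u] is then essentially constant.

On the line, let [f] be bounded on the unit interval with finite energy, the weight
[w] being the even extension of [omega]. Since [w] is bounded below on slopes above
any [e > 0] (it is positive, and its inferior limit at infinity is positive), the
pairs of slope at least [e] integrate [1 / |x - y|] to a finite quantity. Hence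
almost every point is flat, that is, [f] has an approximate derivative 0 there
([flat_ae]). Two flat points [a < b] with [f a < f b] cannot exist. Indeed for
large [m] the map [x |-> f x - m * x] sends a slight enlargement of [[a, b]] into an
interval which is too short by about [J = f b - f a] for the map to be injective
([tent_energy_ge], a pigeonhole principle). The resulting collisions come from
pairs of slope close to [m], and their amount, measured with a tolerance [eta], is
at least a multiple of [J * (eta / m) ^ 2] ([crossing_energy]). Multiply this amount
by [w m] and integrate over [m]. The result is bounded above in terms of the energy,
because each pair sees only the [m] close to its slope, where [w] is close to the
weight of that slope; it is bounded below by a multiple of the integral of
[w m / m ^ 2], which diverges. So [f] is essentially constant ([line_energy_const]).

In higher dimension the energy on a cube dominates the average of the line energies
over all short segments starting in a smaller cube ([slice_energy_le]), so [u] is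
constant along almost every segment. Fixing two times on the segments and changing
variables, [u] agrees at almost every pair of close points, hence is constant near
every point of the domain ([ae_constant_on_cube]). The restriction of [u] to a
segment is meaningful only for a Borel representative ([borel_version]), since the
compositions involved are not measurable for the Lebesgue sigma-algebras. The
changes of variables are homotheties and translations, under which the measure
scales because boxes do ([lebesgue_outer_affine]). Connectedness glues the local
constants ([connected_ae_constant]). *)

Set Implicit Arguments.
Unset Strict Implicit.
Unset Printing Implicit Defensive.
Import Order.TTheory GRing.Theory Num.Theory.
Import numFieldNormedType.Exports.
Local Open Scope classical_set_scope.
Local Open Scope ring_scope.

(** * Integrals of real functions *)

(** Iverson bracket, so that domains of integration and constraints on several
variables can be moved through iterated integrals as factors. *)
Definition iv (R : pzRingType) (b : bool) : R := b%:R.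
Arguments iv {R} b%_R.

Lemma iv_ge0 (R : numDomainType) b : 0 <= iv b :> R.
Proof. exact: ler0n. Qed.

Lemma exists_invS_le (R : archiRealFieldType) (e : R) : 0 < e ->
  exists n : nat, n.+1%:R^-1 <= e.
Proof.
move=> e0; exists (Num.truncn e^-1); rewrite invf_ple ?posrE//.
exact: ltW (truncnS_gt _).
Qed.

Section measurability.
Context d (T : measurableType d) (R : realType).

Lemma measurable_set_of (b : T -> bool) :
  measurable_fun setT b -> measurable [set x | b x].
Proof. by move=> /(_ measurableT [set true] I); rewrite setTI. Qed.

Lemma measurable_iv (b : T -> bool) :
  measurable_fun setT b -> measurable_fun setT (fun x => iv (b x) : R).
Proof.
move=> mb; rewrite (_ : (fun x => _) = fun x => if b x then 1 else 0 : R).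
  by apply: measurable_fun_ifT => //; exact: measurable_cst.
by apply/funext => x; case: (b x).
Qed.

Lemma measurable_normR (g : T -> R) :
  measurable_fun setT g -> measurable_fun setT (fun x => `|g x|).
Proof. by move=> mg; apply: measurableT_comp mg. Qed.

Lemma measurable_normV (g : T -> R) :
  measurable_fun setT g -> measurable_fun setT (fun x => `|g x|^-1).
Proof.
move=> mg; rewrite (_ : (fun x => _) = (fun x => `|g x| `^ (- 1))).
  apply: (measurableT_comp (measurable_powR _)).
  by apply: measurableT_comp mg; exact: normr_measurable.
by apply/funext => x; rewrite powR_inv1.
Qed.

End measurability.

(** The cases are syntactic because a closure lemma applied blindly unifies up to
conversion with almost any integrand. *)
Ltac measR1 :=
  match goal with
  | H : measurable_fun _ ?f |- measurable_fun _ ?g => constr_eq f g; exact: H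
  | |- measurable_fun _ (fun _ => ?c) => exact: measurable_cst
  | |- measurable_fun _ (fun x => x) => exact: measurable_id
  | |- measurable_fun _ (fun x => x.1) => exact: measurable_fst
  | |- measurable_fun _ (fun x => x.2) => exact: measurable_snd
  | |- measurable_fun _ fst => exact: measurable_fst
  | |- measurable_fun _ snd => exact: measurable_snd
  | |- measurable_fun _ (fun x => (@?g x).1) =>
      apply: (measurableT_comp measurable_fst)
  | |- measurable_fun _ (fun x => (@?g x).2) =>
      apply: (measurableT_comp measurable_snd)
  | |- measurable_fun _ (fun x => (@?g x)%:E) => apply/measurable_EFinP
  | |- measurable_fun _ (fun x => iv _) => apply: measurable_iv
  | |- measurable_fun _ (fun x => `|_|^-1) => apply: measurable_normV
  | |- measurable_fun _ (fun x => `|_|) =>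
      apply: measurable_normR
  | |- measurable_fun _ (fun x => _ - _) => apply: measurable_funB
  | |- measurable_fun _ (fun x => - _) => apply: measurable_funN
  | |- measurable_fun _ (fun x => _ + _) => apply: measurable_funD
  | |- measurable_fun _ (fun x => _ * _) => apply: measurable_funM
  | |- measurable_fun _ (fun x => _ ^+ _) => apply: measurable_funX
  | |- measurable_fun _ (fun x => Num.max _ _) => apply: measurable_maxr
  | |- measurable_fun _ (fun x => Num.min _ _) => apply: measurable_minr
  | |- measurable_fun _ (fun x => _ <= _) => apply: measurable_fun_ler
  | |- measurable_fun _ (fun x => _ < _) => apply: measurable_fun_ltr
  | |- measurable_fun _ (fun x => _ == _) => apply: measurable_fun_eqr
  | |- measurable_fun _ (fun x => _ && _) => apply: measurable_and
  | |- measurable_fun _ (fun x => _ || _) => apply: measurable_or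
  | |- measurable_fun _ (fun x => ~~ _) => apply: measurable_neg
  | |- measurable_fun _ id => exact: measurable_id
  | H : ?P |- ?P => exact: H
  | H : measurable_fun setT ?f |- measurable_fun _ (fun x => ?f _) =>
      apply: (measurableT_comp H)
  | |- measurable_fun ?D ?f =>
      lazymatch f with
      | fun _ => _ => fail
      | _ => change (measurable_fun D (fun x => f x))
      end
  end.
Ltac measR := repeat (measR1; rewrite /=).


Section real_integrands.
Context d (T : measurableType d) (R : realType).
Variable m : {measure set T -> \bar R}.
Implicit Types f g : T -> R.

Lemma integral_mulEl (k : R) f :
  0 <= k -> measurable_fun setT f -> (forall x, 0 <= f x) ->
  (\int[m]_x (k * f x)%:E = k%:E * \int[m]_x (f x)%:E)%E.
Proof.
move=> k0 mf f0; under eq_integral do rewrite EFinM.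
rewrite ge0_integralZl_EFin//; first by move=> x _; rewrite lee_fin.
exact/measurable_EFinP.
Qed.

Lemma integral_mulEr (k : R) f :
  0 <= k -> measurable_fun setT f -> (forall x, 0 <= f x) ->
  (\int[m]_x (f x * k)%:E = k%:E * \int[m]_x (f x)%:E)%E.
Proof.
by move=> k0 mf f0; under eq_integral do rewrite mulrC; exact: integral_mulEl.
Qed.

Lemma integral_addE f g :
  measurable_fun setT f -> measurable_fun setT g ->
  (forall x, 0 <= f x) -> (forall x, 0 <= g x) ->
  (\int[m]_x (f x + g x)%:E = \int[m]_x (f x)%:E + \int[m]_x (g x)%:E)%E.
Proof.
move=> mf mg f0 g0; under eq_integral do rewrite EFinD.
rewrite ge0_integralD//; try by move=> x _; rewrite lee_fin.
  exact/measurable_EFinP.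
exact/measurable_EFinP.
Qed.

Lemma le_integralE f g :
  measurable_fun setT f -> measurable_fun setT g ->
  (forall x, 0 <= f x) -> (forall x, f x <= g x) ->
  (\int[m]_x (f x)%:E <= \int[m]_x (g x)%:E)%E.
Proof.
move=> mf mg f0 fg; apply: ge0_le_integral => //.
- by move=> x _; rewrite lee_fin.
- exact/measurable_EFinP.
- exact/measurable_EFinP.
- by move=> x _; rewrite lee_fin.
Qed.

End real_integrands.

(** Lebesgue measure on [R] with its canonical measurable structure, whereas
[lebesgue_measure] lives on a copy of [R] with another display, which hides the
measurability of ordinary real functions from unification. *)
Definition lam (R : realType) : set R -> \bar R := @lebesgue_measure R.

Section lam_measure.
Context (R : realType).
Local Notation lam := (@lam R).

Let lam0 : lam set0 = 0%E. Proof. exact: measure0. Qed.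

Let lam_ge0 A : (0 <= lam A)%E. Proof. exact: measure_ge0. Qed.

Let lam_sigma_additive : semi_sigma_additive lam.
Proof. exact: (@measure_semi_sigma_additive _ _ _ (@lebesgue_measure R)). Qed.

HB.instance Definition _ := isMeasure.Build _ R R lam
  lam0 lam_ge0 lam_sigma_additive.

Let lam_sigma_finite : sigma_finite setT lam.
Proof. exact: (@sigma_finiteT _ _ _ (@lebesgue_measure R)). Qed.

HB.instance Definition _ := @Measure_isSigmaFinite.Build _ R R lam
  lam_sigma_finite.

Lemma lamE (A : set R) : lam A = lebesgue_measure A. Proof. by []. Qed.

Lemma ge0_integral_lam (D : set R) (f : R -> \bar R) :
  measurable D -> measurable_fun D f -> (forall x, D x -> (0 <= f x)%E) ->
  (\int[lam]_(x in D) f x = \int[lebesgue_measure]_(x in D) f x)%E.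
Proof.
move=> mD mf f0.
pose idR : measurableTypeR R -> R := id.
have mid : measurable_fun setT idR by move=> _ A mA; rewrite setTI.
transitivity (\int[pushforward (@lebesgue_measure R) idR]_(x in D) f x)%E.
  by apply: eq_measure_integral.
rewrite (ge0_integral_pushforward mid)//.
by move=> x; rewrite inE; exact: f0.
Qed.

End lam_measure.

(** The product measure under a name of its own, so that it is registered as
sigma-finite and can be a factor in another iterated integral. *)
Definition tensor d1 d2 (T1 : measurableType d1) (T2 : measurableType d2)
  (R : realType) (m1 : {sigma_finite_measure set T1 -> \bar R})
  (m2 : {sigma_finite_measure set T2 -> \bar R}) : set (T1 * T2) -> \bar R :=
  (m1 \x m2)%E.

Section tensor_measure.
Context d1 d2 (T1 : measurableType d1) (T2 : measurableType d2) (R : realType)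
  (m1 : {sigma_finite_measure set T1 -> \bar R})
  (m2 : {sigma_finite_measure set T2 -> \bar R}).

HB.instance Definition _ := Measure.copy (tensor m1 m2) (m1 \x m2)%E.

Let tensor_sigma_finite : sigma_finite setT (tensor m1 m2).
Proof.
have [F FT Ffin] := sigma_finiteT m1; have [G GT Gfin] := sigma_finiteT m2.
pose code k : nat * nat := odflt (0%N, 0%N) (unpickle k).
exists (fun k => F (code k).1 `*` G (code k).2).
  apply/esym; rewrite -subTset => -[x y] _.
  have : setT x by []. have : setT y by [].
  rewrite GT FT => -[j _ Gy] [i _ Fx].
  by exists (pickle (i, j)) => //; rewrite /code pickleK.
move=> k; have [mF oF] := Ffin (code k).1; have [mG oG] := Gfin (code k).2.
split; first exact: measurableX.
rewrite /tensor product_measure1E// lte_mul_pinfty//.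
by rewrite ge0_fin_numE.
Qed.

HB.instance Definition _ := @Measure_isSigmaFinite.Build _ _ R (tensor m1 m2)
  tensor_sigma_finite.

End tensor_measure.

Section iterated_integrals.
Context d1 d2 d3 (T1 : measurableType d1) (T2 : measurableType d2)
  (T3 : measurableType d3) (R : realType).
Variables (m1 : {sigma_finite_measure set T1 -> \bar R})
  (m2 : {sigma_finite_measure set T2 -> \bar R}).
Local Open Scope ereal_scope.

Lemma tonelliC (F : T1 -> T2 -> \bar R) :
  measurable_fun setT (fun z : T1 * T2 => F z.1 z.2) ->
  (forall x y, 0 <= F x y) ->
  \int[m1]_x \int[m2]_y F x y = \int[m2]_y \int[m1]_x F x y.
Proof.
by move=> mF F0; exact: (fubini_tonelli _ mF (fun z => F0 z.1 z.2)).
Qed.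

Lemma integral_prodE (F : T1 -> T2 -> \bar R) :
  measurable_fun setT (fun z : T1 * T2 => F z.1 z.2) ->
  (forall x y, 0 <= F x y) ->
  \int[tensor m1 m2]_z F z.1 z.2 = \int[m1]_x \int[m2]_y F x y.
Proof.
by move=> mF F0; exact: (fubini_tonelli1 _ mF (fun z => F0 z.1 z.2)).
Qed.

Lemma measurable_partial_integral (F : T3 -> T2 -> \bar R) :
  measurable_fun setT (fun z : T3 * T2 => F z.1 z.2) ->
  (forall x y, 0 <= F x y) ->
  measurable_fun setT (fun x => \int[m2]_y F x y).
Proof.
by move=> mF F0; exact: (measurable_fun_fubini_tonelli_F (m2 := m2) _ mF (fun z => F0 z.1 z.2)).
Qed.

End iterated_integrals.

Section double_integrals.
Context d1 d2 (T1 : measurableType d1) (T2 : measurableType d2) (R : realType).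
Variables (m1 : {sigma_finite_measure set T1 -> \bar R})
  (m2 : {sigma_finite_measure set T2 -> \bar R}).
Implicit Types F G : T1 -> T2 -> R.
Notation measurable2 F := (measurable_fun setT (fun z : T1 * T2 => F z.1 z.2)).

Lemma measurable_curry F x : measurable2 F -> measurable_fun setT (F x).
Proof. by move=> mF; exact: (measurableT_comp mF (pair1_measurable x)). Qed.

Lemma measurable_integral2 F : measurable2 F -> (forall x y, 0 <= F x y) ->
  measurable_fun setT (fun x => \int[m2]_y (F x y)%:E)%E.
Proof.
move=> mF F0; apply: measurable_partial_integral; first exact/measurable_EFinP.
by move=> x y; rewrite lee_fin.
Qed.

Lemma integral2_ge0 F : (forall x y, 0 <= F x y) ->
  (0 <= \int[m1]_x \int[m2]_y (F x y)%:E)%E.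
Proof.
by move=> F0; apply: integral_ge0 => x _; apply: integral_ge0 => y _; rewrite lee_fin.
Qed.

Lemma le_integral2E F G : measurable2 F -> measurable2 G ->
  (forall x y, 0 <= F x y) -> (forall x y, F x y <= G x y) ->
  (\int[m1]_x \int[m2]_y (F x y)%:E <= \int[m1]_x \int[m2]_y (G x y)%:E)%E.
Proof.
move=> mF mG F0 FG; have G0 x y : 0 <= G x y by exact: le_trans (FG x y).
apply: ge0_le_integral => //.
- by move=> x _; apply: integral_ge0 => y _; rewrite lee_fin.
- exact: measurable_integral2.
- exact: measurable_integral2.
- by move=> x _; apply: le_integralE => //; exact: measurable_curry.
Qed.

Lemma integral2_addE F G : measurable2 F -> measurable2 G ->
  (forall x y, 0 <= F x y) -> (forall x y, 0 <= G x y) ->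
  (\int[m1]_x \int[m2]_y (F x y + G x y)%:E =
   \int[m1]_x \int[m2]_y (F x y)%:E + \int[m1]_x \int[m2]_y (G x y)%:E)%E.
Proof.
move=> mF mG F0 G0; rewrite -ge0_integralD//.
- by apply: eq_integral => x _; rewrite integral_addE//; exact: measurable_curry.
- by move=> x _; apply: integral_ge0 => y _; rewrite lee_fin.
- exact: measurable_integral2.
- by move=> x _; apply: integral_ge0 => y _; rewrite lee_fin.
- exact: measurable_integral2.
Qed.

Lemma integral2_mulEl k F : 0 <= k -> measurable2 F -> (forall x y, 0 <= F x y) ->
  (\int[m1]_x \int[m2]_y (k * F x y)%:E =
   k%:E * \int[m1]_x \int[m2]_y (F x y)%:E)%E.
Proof.
move=> k0 mF F0; rewrite -ge0_integralZl_EFin//.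
- by apply: eq_integral => x _; rewrite integral_mulEl//; exact: measurable_curry.
- by move=> x _; apply: integral_ge0 => y _; rewrite lee_fin.
- exact: measurable_integral2.
Qed.

End double_integrals.

Section tails.
Context d (T : measurableType d) (R : realType).
Variable m : {measure set T -> \bar R}.

(** Absolute continuity of the integral along the shrinking sets [h < r]. *)
Lemma integral_tail_small (g h : T -> R) :
  measurable_fun setT g -> measurable_fun setT h ->
  (forall z, 0 <= g z) -> (forall z, h z <= 0 -> g z = 0) ->
  (\int[m]_z (g z)%:E < +oo)%E ->
  forall e, 0 < e -> exists2 r, 0 < r &
    (\int[m]_z (g z * iv (h z < r))%:E <= e%:E)%E.
Proof.
move=> mg mh g0 gh gfin e e0.
pose u n z := (g z * iv (n.+1%:R^-1 <= h z))%:E.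
have mu n : measurable_fun setT (u n) by rewrite /u; measR.
have u0 n z : (0 <= u n z)%E by rewrite lee_fin mulr_ge0 ?iv_ge0.
have undecr z : nondecreasing_seq (u^~ z).
  move=> i j ij; rewrite lee_fin ler_wpM2l// /iv ler_nat.
  have [h1|] //= := boolP (i.+1%:R^-1 <= h z); rewrite (le_trans _ h1)//.
  by rewrite lef_pV2 ?posrE// ler_nat.
have ulim z : limn (u^~ z) = (g z)%:E.
  apply/cvg_lim => //; have [hz|hz] := leP (h z) 0.
    by rewrite /u gh//; under eq_fun do rewrite mul0r; exact: cvg_cst.
  apply: cvg_near_cst; near=> n; rewrite /u /iv.
  suff -> : n.+1%:R^-1 <= h z by rewrite mulr1.
  rewrite invf_ple ?posrE//.
  apply: (@le_trans _ _ n%:R); last by rewrite ler_nat.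
  by near: n; exact: nbhs_infty_ger.
have := monotone_convergence m measurableT mu (fun n z _ => u0 n z)
  (fun z _ => undecr z).
under eq_integral do rewrite ulim.
move=> intE.
have nd : nondecreasing_seq (fun n => \int[m]_z u n z)%E.
  move=> i j ij; apply: ge0_le_integral => // z _; exact: undecr.
have := ereal_nondecreasing_cvgn nd => /cvg_lim; rewrite -intE => /(_ (@ereal_hausdorff R)) supE.
have Lfin : (\int[m]_z (g z)%:E)%E \is a fin_num.
  by rewrite ge0_fin_numE//; apply: integral_ge0 => z _; rewrite lee_fin.
have : (\int[m]_z (g z)%:E - e%:E < ereal_sup (range (fun n => \int[m]_z u n z)))%E.
  by rewrite -supE lteBlDr// lteDl.
move=> /ereal_sup_gt[_ [n _ <-] lt_n].
exists (n.+1%:R^-1) => //.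
have gE : (\int[m]_z (g z)%:E = \int[m]_z (g z * iv (h z < n.+1%:R^-1))%:E
    + \int[m]_z u n z)%E.
  rewrite -integral_addE.
  - apply: eq_integral => z _; rewrite -mulrDr /iv; case: ltP => _.
      by rewrite addr0 mulr1.
    by rewrite add0r mulr1.
  - by measR.
  - by measR.
  - by move=> z; rewrite mulr_ge0 ?iv_ge0.
  - by move=> z; rewrite mulr_ge0 ?iv_ge0.
move: lt_n; rewrite {1}gE.
have : (\int[m]_z u n z)%E \is a fin_num.
  rewrite ge0_fin_numE; last by apply: integral_ge0.
  apply: le_lt_trans gfin; rewrite gE leeDr//.
  by apply: integral_ge0 => z _; rewrite lee_fin mulr_ge0 ?iv_ge0.
move: (\int[m]_z u n z)%E => [v| |]// _.
move: (\int[m]_z (g z * iv _)%:E)%E => [p| |]//; last by rewrite leNye.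
by rewrite lteBlDr// -!EFinD lte_fin lee_fin; lra.
Unshelve. all: by end_near. Qed.

End tails.

Lemma ae_lty d (T : measurableType d) (R : realType)
  (m : {measure set T -> \bar R}) (f : T -> \bar R) :
  measurable_fun setT f -> (forall x, 0 <= f x)%E -> (\int[m]_x f x < +oo)%E ->
  {ae m, forall x, (f x < +oo)%E}.
Proof.
move=> mf f0 ffin.
have fi : m.-integrable setT f.
  by apply/integrableP; split=> //; under eq_integral do rewrite gee0_abs//.
have := integrable_ae measurableT fi.
by apply: filterS => x /(_ I) fx; rewrite -ge0_fin_numE.
Qed.

Section null_integrals.
Context d (T : measurableType d) (R : realType) (m : {measure set T -> \bar R}).
Implicit Types f : T -> \bar R.

Lemma ae_eq0_integral f : measurable_fun setT f -> (forall x, 0 <= f x)%E ->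
  (\int[m]_x f x = 0)%E -> {ae m, forall x, f x = 0%E}.
Proof.
move=> mf f0 intf.
have : (\int[m]_x `|f x| = 0)%E by under eq_integral do rewrite gee0_abs//.
move=> /(ae_eq_integral_abs m measurableT mf).
by apply: filterS => x /(_ I).
Qed.

Lemma integral_ae_eq0 f : measurable_fun setT f ->
  {ae m, forall x, f x = 0%E} -> (\int[m]_x f x = 0)%E.
Proof.
move=> mf f0; rewrite (ae_eq_integral (cst 0%E))//.
- by rewrite integral0_eq.
- by apply: filterS f0 => x fx _.
Qed.

Lemma ae_exists (P : T -> Prop) (D : set T) : measurable D -> m D != 0%E ->
  {ae m, forall x, P x} -> exists2 x, D x & P x.
Proof.
move=> mD D0 aeP; apply: contrapT => noP; move/eqP: D0; apply.
apply: (measure_negligible mD); move: aeP; apply: negligibleS => x Dx Px.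
by apply: noP; exists x.
Qed.

End null_integrals.

(** * Windows and a quantitative pigeonhole principle *)

Section windows.
Context (R : realType).
Notation lam := (@lam R).
Implicit Types (t p q v eta : R).

Definition win eta t v : R := iv (t <= v <= t + eta).

Lemma win_ge0 eta t v : 0 <= win eta t v.
Proof. exact: iv_ge0. Qed.

Lemma measurable_win d (T : measurableType d) eta (f g : T -> R) :
  measurable_fun setT f -> measurable_fun setT g ->
  measurable_fun setT (fun z => win eta (f z) (g z)).
Proof. by move=> mf mg; rewrite /win; measR. Qed.

Lemma integral_iv_itv (b : R -> bool) (lo hi : R) :
  (forall x, b x = (lo <= x <= hi)) ->
  (\int[lam]_x (iv (b x))%:E = (Num.max 0 (hi - lo))%:E)%E.
Proof.
move=> bE.
under eq_integral => x _ do
  (rewrite (_ : iv (b x) = \1_(`[lo, hi]%classic) x); last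
    by rewrite indicE bE mem_setE in_itv).
rewrite integral_indic//= setIT lamE lebesgue_measure_itv/= lte_fin.
case: ltP => h; last by rewrite max_l ?subr_le0.
by rewrite -EFinB max_r// subr_ge0 ltW.
Qed.

Lemma integral_win eta v : 0 <= eta -> (\int[lam]_t (win eta t v)%:E = eta%:E)%E.
Proof.
move=> eta0; rewrite (integral_iv_itv (lo := v - eta) (hi := v)).
  by congr EFin; rewrite max_r; lra.
by move=> x; apply/idP/idP => /andP[? ?]; apply/andP; split; lra.
Qed.

Lemma integral_win_scaled eta (k t : R) : 0 <= eta -> 0 < k ->
  (\int[lam]_y (win eta t (k * y))%:E = (eta / k)%:E)%E.
Proof.
move=> eta0 k0; rewrite (integral_iv_itv (lo := t / k) (hi := (t + eta) / k)).
  by rewrite -mulrBl addrAC subrr add0r max_r// divr_ge0// ltW.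
by move=> x; rewrite ler_pdivrMr// ler_pdivlMr// ![x * k]mulrC.
Qed.

(** The overlap of two windows, that is, the measure of the positions [t] for
which both [p] and [q] lie in [[t, t + eta]]. *)
Definition tent eta p q : R := Num.max 0 (eta - `|p - q|).

Lemma tent_ge0 eta p q : 0 <= tent eta p q.
Proof. by rewrite le_max lexx. Qed.

Lemma integral_win_win eta p q :
  (\int[lam]_t (win eta t p * win eta t q)%:E = (tent eta p q)%:E)%E.
Proof.
under eq_integral do rewrite /win /iv -natrM mulnb.
rewrite -/(iv _).
rewrite (integral_iv_itv (lo := Num.max p q - eta) (hi := Num.min p q)).
  rewrite /tent; congr (Num.max _ _)%:E.
  by case: (lerP p q) => h; lra.
move=> x; rewrite -lerBlDr le_min lerBlDr.
apply/idP/idP.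
  by move=> /andP[/andP[? ?] /andP[? ?]]; case: (lerP p q) => h;
    apply/and3P; split; lra.
by case: (lerP p q) => h /and3P[? ? ?]; apply/andP; split; apply/andP; split; lra.
Qed.

Lemma integral_tent_scaled eta (k x : R) : 0 <= eta -> 0 < k ->
  (\int[lam]_y (tent eta (k * x) (k * y))%:E = (eta ^+ 2 / k)%:E)%E.
Proof.
move=> eta0 k0.
under eq_integral do rewrite -integral_win_win.
rewrite tonelliC; last 2 first.
- by apply/measurable_EFinP/measurable_funM; apply: measurable_win; measR.
- by move=> y t; rewrite lee_fin mulr_ge0 ?win_ge0.
under eq_integral => t _.
  rewrite integral_mulEl ?win_ge0//; last by apply: measurable_win; measR.
  rewrite integral_win_scaled// -EFinM.
  over.
rewrite integral_mulEr.
- by rewrite integral_win// -EFinM; congr EFin; rewrite expr2 mulrAC.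
- by rewrite divr_ge0// ltW.
- by apply: measurable_win; measR.
- by move=> y; exact: win_ge0.
Qed.

Lemma lee_2mule (c : R) (m : \bar R) : 0 <= c -> (0 <= m < +oo)%E ->
  ((2 * c)%:E * m <= m * m + (c ^+ 2)%:E)%E.
Proof.
move=> c0; case: m => [m _|/andP[_]|/andP[]]//.
by rewrite -!EFinM -EFinD lee_fin; have := sqr_ge0 (m - c); nra.
Qed.

(** Pigeonhole principle in quantitative form: if [v] maps a set [A] into an
interval of length [hi - lo] that is too short, many pairs of points of [A]
must have images within [eta] of each other. The pairs are counted by
squaring the mass [m t] that [v] puts on the window [[t, t + eta]], and the
square is linearized by [m t ^ 2 >= 2 * c * m t - c ^ 2]; the best [c] is the mass of a
window when the total mass is spread evenly. *)
Lemma tent_energy_ge (A : set R) (v : R -> R) (lo hi eta c : R) :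
  measurable A -> (lam A < +oo)%E -> measurable_fun setT v ->
  (forall x, A x -> lo <= v x <= hi) -> 0 <= eta -> 0 <= c ->
  lo <= hi ->
  ((2 * c * eta)%:E * lam A <=
   \int[lam]_x \int[lam]_y (\1_A x * \1_A y * tent eta (v x) (v y))%:E
     + (c ^+ 2 * (hi - lo + eta))%:E)%E.
Proof.
move=> mA Afin mv vA eta0 c0 lohi.
have mA1 : measurable_fun setT (\1_A : R -> R) by [].
pose m t := (\int[lam]_x (\1_A x * win eta t (v x))%:E)%E.
have A0 x : 0 <= \1_A x :> R by rewrite indicE ler0n.
have mF : measurable_fun setT (fun z : R * R => \1_A z.2 * win eta z.1 (v z.2)).
  by apply: measurable_funM; [measR|apply: measurable_win; measR].
have mm : measurable_fun setT m.
  apply: (measurable_partial_integral _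
    (F := fun t x => (\1_A x * win eta t (v x))%:E)).
    exact/measurable_EFinP.
  by move=> t x; rewrite lee_fin mulr_ge0 ?win_ge0.
have m0 t : (0 <= m t)%E.
  by apply: integral_ge0 => x _; rewrite lee_fin mulr_ge0 ?win_ge0.
have win1 t x : win eta t x <= 1 by rewrite /win /iv lern1 leq_b1.
have mfin t : (m t < +oo)%E.
  apply: le_lt_trans Afin.
  rewrite [leRHS](_ : _ = \int[lam]_x (\1_A x)%:E)%E; last first.
    by rewrite integral_indic// setIT.
  apply: le_integralE => //.
  - by apply: measurable_funM => //; apply: measurable_win; measR.
  - by move=> x; rewrite mulr_ge0 ?win_ge0.
  - by move=> x; rewrite ler_piMr.
have mint : (lam A = \int[lam]_x (\1_A x)%:E)%E.
  by rewrite integral_indic// setIT.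
have mw : measurable_fun setT (fun z : (R * R) * R =>
    \1_A z.1.1 * win eta z.2 (v z.1.1) * (\1_A z.1.2 * win eta z.2 (v z.1.2))).
  apply: measurable_funM; apply: measurable_funM; try (by measR);
    by apply: measurable_win; measR.
(* The second moment of the window masses is the tent energy. *)
have sumE : (\int[lam]_x \int[lam]_y (\1_A x * \1_A y * tent eta (v x) (v y))%:E
    = \int[lam]_t (m t * m t))%E.
  transitivity (\int[lam]_x \int[lam]_y \int[lam]_t
      (\1_A x * win eta t (v x) * (\1_A y * win eta t (v y)))%:E)%E.
    apply: eq_integral => x _; apply: eq_integral => y _.
    under [RHS]eq_integral do rewrite mulrACA.
    rewrite integral_mulEl ?mulr_ge0//; last 2 first.
    - by apply: measurable_funM; apply: measurable_win; measR.
    - by move=> t; rewrite mulr_ge0 ?win_ge0.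
    by rewrite integral_win_win EFinM.
  transitivity (\int[lam]_x \int[lam]_t \int[lam]_y
      (\1_A x * win eta t (v x) * (\1_A y * win eta t (v y)))%:E)%E.
    apply: eq_integral => x _; rewrite tonelliC//.
      apply/measurable_EFinP.
      apply: (measurableT_comp mw (measurable_fun_pair
        (measurable_fun_pair (measurable_cst x) measurable_fst) measurable_snd)).
    by move=> y t; rewrite lee_fin !mulr_ge0 ?win_ge0.
  rewrite tonelliC; last 2 first.
  - apply: (measurable_partial_integral _ (F := fun (z : R * R) y =>
      (\1_A z.1 * win eta z.2 (v z.1) * (\1_A y * win eta z.2 (v y)))%:E)).
      apply/measurable_EFinP.
      apply: (measurableT_comp mw (measurable_fun_pair
        (measurable_fun_pair _ _) _)); measR.
    by move=> z y; rewrite lee_fin !mulr_ge0 ?win_ge0.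
  - move=> x t; apply: integral_ge0 => y _.
    by rewrite lee_fin !mulr_ge0 ?win_ge0.
  apply: eq_integral => t _.
  under eq_integral => x _.
    rewrite integral_mulEl ?mulr_ge0 ?win_ge0//; last 2 first.
    - by apply: measurable_funM => //; apply: measurable_win; measR.
    - by move=> y; rewrite mulr_ge0 ?win_ge0.
    rewrite -/(m t); over.
  rewrite /= ge0_integralZr//.
  - by apply/measurable_EFinP/measurable_funM => //; apply: measurable_win; measR.
  - by move=> x _; rewrite lee_fin mulr_ge0 ?win_ge0.
have sum1 : (eta%:E * lam A = \int[lam]_t m t)%E.
  rewrite /m tonelliC; last 2 first.
  - exact/measurable_EFinP.
  - by move=> t x; rewrite lee_fin mulr_ge0 ?win_ge0.
  under [RHS]eq_integral => x _.
    rewrite integral_mulEl ?A0//; last by rewrite /win; measR.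
    rewrite integral_win// -EFinM; over.
  by rewrite integral_mulEr// mint.
(* Only windows that meet [[lo, hi]] count, which is what limits the cost of the
linearization. *)
have supp t : ~~ (lo - eta <= t <= hi) -> m t = 0%E.
  move=> ht; apply: integral0_eq => x _; rewrite /win /iv indicE.
  have [xA|xA] := boolP (x \in A); last by rewrite mul0r.
  have /andP[vlo vhi] := vA _ (set_mem xA).
  case: (boolP (_ <= _ <= _)) => [/andP[h1 h2]|]; last by rewrite mulr0.
  by case/negP: ht; apply/andP; split; lra.
rewrite sumE EFinM -muleA sum1.
rewrite -ge0_integralZl_EFin//; last by rewrite mulr_ge0.
have -> : ((c ^+ 2 * (hi - lo + eta))%:E
    = \int[lam]_t (c ^+ 2 * iv (lo - eta <= t <= hi))%:E)%E.
  rewrite integral_mulEl ?sqr_ge0//; last by measR.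
  rewrite (integral_iv_itv (lo := lo - eta) (hi := hi))// max_r; last by lra.
  by rewrite -EFinM; congr (_ * _)%:E; lra.
rewrite -ge0_integralD//; last 4 first.
- by move=> t _; rewrite mule_ge0.
- exact: emeasurable_funM.
- by move=> t _; rewrite lee_fin mulr_ge0 ?sqr_ge0 ?iv_ge0.
- by measR.
apply: ge0_le_integral => //.
- by move=> t _; rewrite mule_ge0// lee_fin mulr_ge0.
- exact: measurable_funeM.
- by apply: emeasurable_funD; [exact: emeasurable_funM|measR].
move=> t _; have [ht|ht] := boolP (lo - eta <= t <= hi).
  by rewrite /iv mulr1 lee_2mule// m0 mfin.
by rewrite supp// !mule0 add0e lee_fin mulr_ge0 ?sqr_ge0 ?iv_ge0.
Qed.

End windows.

(** * Energy forced by two flat points with different values *)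

Section crossing.
Context (R : realType).
Notation lam := (@lam R).
Implicit Types (f : R -> R) (a b e l M : R).

(** A measure-theoretic form of [f] having derivative zero at [a]: in small
intervals around [a] the points where [f] moves by a fixed fraction of the length
have small density. *)
Definition flat_at f a := forall e, 0 < e -> exists2 r : R, 0 < r &
  forall l, 0 < l <= r ->
    (lam [set x | ((`|x - a| <= l) && (e * l < `|f x - f a|))%R] <= (e * l)%:E)%E.

Definition steep f e x y : R :=
  iv (0 < x < 1) * iv (0 < y < 1) * iv (e * `|x - y| < `|f x - f y|).

Lemma steep_ge0 f e x y : 0 <= steep f e x y.
Proof. by rewrite !mulr_ge0 ?iv_ge0. Qed.

Lemma measurable_steep d (T : measurableType d) f e (p q : T -> R) :
  measurable_fun setT f -> measurable_fun setT p -> measurable_fun setT q ->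
  measurable_fun setT (fun z => steep f e (p z) (q z)).
Proof. by move=> mf mp mq; rewrite /steep; measR. Qed.

(** With [c = eta / m], all the terms of order [m] in the pigeonhole inequality
cancel and [J] is what remains; the errors are small multiples of [J] by the
choice of [e] and [eta]. *)
Let crossing_arith (J M e D L m k eta : R) :
  0 < J -> 0 < e -> e * (20 * M + 2) = J / 4 -> 0 <= D <= 1 -> m * L = 2 * M ->
  L <= 2 * M -> 2 <= m -> e <= 1 -> k = m - e -> 0 < eta <= J / 4 -> 0 <= M -> 0 <= L ->
  J / 2 * (eta / m) ^+ 2 <= 2 * (eta / m) * eta * (D + 2 * L - 2 * e * L)
     - (D + 2 * L) * (eta ^+ 2 / k)
     - (eta / m) ^+ 2 * (m * D + 4 * M - J + 2 * e * L + eta).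
Proof.
move=> J0 e0 eJ /andP[D0 D1] mL LM m2 e1 kE /andP[eta0 etaJ] M0 L0.
have k0 : 0 < k by lra.
have m0 : 0 < m by lra.
have mk : m ^+ 2 / k <= m + 2 * e.
  by rewrite ler_pdivrMr// kE; nra.
have -> : 2 * (eta / m) * eta * (D + 2 * L - 2 * e * L) =
    (eta / m) ^+ 2 * (2 * (m * D + 2 * (m * L) - 2 * e * (m * L))).
  by field; rewrite gt_eqF.
have -> : (D + 2 * L) * (eta ^+ 2 / k) = (eta / m) ^+ 2 * ((D + 2 * L) * (m ^+ 2 / k)).
  by field; rewrite !gt_eqF.
rewrite -!mulrBr mulrC ler_wpM2l ?sqr_ge0// mL.
have DL0 : 0 <= D + 2 * L by lra.
have h : (D + 2 * L) * (m ^+ 2 / k) <= (D + 2 * L) * (m + 2 * e) by exact: ler_wpM2l.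
have h2 : (D + 2 * L) * (m + 2 * e) = m * D + 2 * (m * L) + 2 * e * (D + 2 * L) by ring.
rewrite mL in h2.
have h3 : e * L <= e * (2 * M) by rewrite ler_pM2l.
have h4 : e * D <= e * 1 by rewrite ler_pM2l.
lra.
Qed.

(** Left of [a] the drift adds at most [m * L = 2 * M] to a value which is almost
[f a - m * a]; right of [a] the crude bound [f x <= M <= f a + 2 * M] suffices.
Likewise at [b]. *)
Let drift_range (M a b fa fb m L eL x fx : R) :
  0 < m -> a < b -> 0 < L -> m * L = 2 * M -> 0 <= eL ->
  `|fa| <= M -> `|fb| <= M -> `|fx| <= M -> a - L <= x <= b + L ->
  (`|x - a| <= L -> `|fx - fa| <= eL) ->
  (`|x - b| <= L -> `|fx - fb| <= eL) ->
  fb - 2 * M - m * b - eL <= fx - m * x <= fa + 2 * M - m * a + eL.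
Proof.
move=> m0 ab L0 mL eL0 /ler_normlP[? ?] /ler_normlP[? ?] /ler_normlP[? ?].
move=> /andP[xl xr] ha hb.
have mab : m * a < m * b by rewrite ltr_pM2l.
have mxl : m * (a - L) <= m * x by rewrite ler_pM2l.
have mxr : m * x <= m * (b + L) by rewrite ler_pM2l.
rewrite mulrBr mL in mxl; rewrite mulrDr mL in mxr.
have [xla|xla] := leP x a.
  have /ha /ler_normlP[? ?] : `|x - a| <= L.
    by rewrite ler_norml; apply/andP; split; lra.
  have mxa : m * x <= m * a by rewrite ler_pM2l.
  by apply/andP; split; lra.
have mxa : m * a < m * x by rewrite ltr_pM2l.
have [xlb|xlb] := leP x b.
  have mxb : m * x <= m * b by rewrite ler_pM2l.
  by apply/andP; split; lra.
have mxb : m * b < m * x by rewrite ltr_pM2l.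
have /hb /ler_normlP[? ?] : `|x - b| <= L.
  by rewrite ler_norml; apply/andP; split; lra.
by apply/andP; split; lra.
Qed.

(** Two points where [f] is flat but takes different values [f a < f b] force
interactions of slope close to every large [m]: the map [x |-> f x - m * x]
sends a neighbourhood of [[a, b]] of length [b - a + 4 M / m] into an interval
which is shorter than [m] times that length by almost [f b - f a], because near
[a] and [b] the map is almost a translate of [x |-> - m * x]. By the pigeonhole
inequality it is far from injective; pairs which are not steep contribute no
more than they do for [x |-> - m * x] itself, so the excess comes from steep
pairs. *)
Lemma crossing_energy f M a b :
  measurable_fun setT f -> (forall x, `|f x| <= M) ->
  0 < a -> a < b -> b < 1 -> flat_at f a -> flat_at f b -> f a < f b ->
  exists e J m0 eta0, [/\ 0 < e, 0 < J, 1 <= m0, 0 < eta0 &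
    forall m eta, m0 <= m -> 0 < eta <= eta0 ->
    ((J * (eta / m) ^+ 2)%:E <= \int[lam]_x \int[lam]_y
      (steep f e x y * tent eta (f x - m * x) (f y - m * y))%:E)%E].
Proof.
move=> mf fM a0 ab b1 fa fb fab.
have /ler_normlP[faM1 faM2] := fM a; have /ler_normlP[fbM1 fbM2] := fM b.
set J := f b - f a; have J0 : 0 < J by rewrite subr_gt0.
have M0 : 0 < M by lra.
have JM : J <= 2 * M by rewrite /J; lra.
(* Besides [eta], the errors in the pigeonhole inequality add up to at most
[e * (20 * M + 2)]. *)
pose e := J / 4 / (20 * M + 2).
have den0 : 0 < 20 * M + 2 by lra.
have e0 : 0 < e by rewrite !divr_gt0.
have eJ : e * (20 * M + 2) = J / 4 by rewrite /e divfK// gt_eqF.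
have e1 : e <= 1 by rewrite /e ler_pdivrMr//; lra.
have [ra ra0 Pa] := fa e e0; have [rb rb0 Pb] := fb e e0.
pose r := Num.min (Num.min ra rb) (Num.min a (1 - b)).
have r0 : 0 < r by rewrite !lt_min ra0 rb0 a0/= subr_gt0.
exists e, (J / 2), (2 + 2 * M / r), (J / 4); split => //; try by lra.
  by have := divr_ge0 (ltW M0) (ltW r0); lra.
move=> m eta mge /andP[eta0 etaJ].
have Mr0 : 0 < M / r by rewrite divr_gt0.
have m2 : 2 <= m by lra.
have m0 : 0 < m by lra.
(* Over the length [L] the drift [m * x] equals the crude bound [2 * M] on the
oscillation of [f]. *)
pose L := 2 * M / m.
have L0 : 0 < L by rewrite divr_gt0// mulr_gt0.
have mL : m * L = 2 * M by rewrite /L mulrC divfK// gt_eqF.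
have LM : L <= 2 * M by rewrite /L ler_pdivrMr// ler_peMr; lra.
have Lr : L < r.
  rewrite /L ltr_pdivrMr// -ltr_pdivrMl//; apply: lt_le_trans mge.
  by rewrite mulrC; lra.
have : L < r by []. rewrite !lt_min => /andP[/andP[Lra Lrb] /andP[La Lb]].
have aL0 : 0 < a - L by rewrite subr_gt0.
have bL1 : b + L < 1 by rewrite -ltrBrDl.
pose bad c := [set x | (`|x - c| <= L) && (e * L < `|f x - f c|)].
have mbad c : measurable (bad c).
  by apply: measurable_set_of; measR.
pose I := `[a - L, b + L]%classic.
pose A := (I `\` bad a) `\` bad b.
have mI : measurable I by exact: measurable_itv.
have mA : measurable A by do 2 apply: measurableD => //.
have lamI : lam I = (b - a + 2 * L)%:E.
  rewrite lamE /I lebesgue_measure_itv/= lte_fin ifT; last by lra.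
  by rewrite -EFinB; congr EFin; lra.
have AI : A `<=` I by move=> x [[]].
have lamA : ((b - a + 2 * L - 2 * e * L)%:E <= lam A)%E.
  have : (lam I <= lam A + lam (bad a) + lam (bad b))%E.
    apply: (@le_trans _ _ (lam (A `|` bad a `|` bad b))).
      apply: le_measure; rewrite ?inE//; first by do 2 apply: measurableU => //.
      move=> x xI; have [xb|xb] := pselect (bad b x); first by right.
      by left; have [xa|xa] := pselect (bad a x); [right|left].
    apply: (le_trans (measureU2 _ _ _)) => //; first exact: measurableU.
    by apply: leeD => //; exact: measureU2.
  have Pa' := Pa L; have Pb' := Pb L.
  have /Pa'{}Pa' : 0 < L <= ra by rewrite L0 ltW.
  have /Pb'{}Pb' : 0 < L <= rb by rewrite L0 ltW.
  rewrite lamI => h.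
  have {h} := le_trans h (leeD (leeD (lexx _) Pa') Pb').
  have : (0 <= lam A)%E by exact: measure_ge0.
  case: (lam A) => [s| |]//; last by move=> *; rewrite leey.
  by rewrite -!EFinD !lee_fin; lra.
pose v x := f x - m * x.
have mv : measurable_fun setT v by rewrite /v; measR.
pose lo := f b - 2 * M - m * b - e * L.
pose hi := f a + 2 * M - m * a + e * L.
have mab : m * a < m * b by rewrite ltr_pM2l.
have eL0 : 0 < e * L by rewrite mulr_gt0.
have vA x : A x -> lo <= v x <= hi.
  move=> [[xI /= xa] xb]; move: xI; rewrite /I/= in_itv/= => xI.
  apply: (drift_range m0 ab L0 mL (ltW eL0) (fM a) (fM b) (fM x) xI).
  - by move=> h; have /negP := xa; rewrite /bad/= h/= -leNgt.
  - by move=> h; have /negP := xb; rewrite /bad/= h/= -leNgt.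
have lohi : lo <= hi by rewrite /lo /hi; lra.
have Afin : (lam A < +oo)%E.
  apply: (@le_lt_trans _ _ (lam I)); last by rewrite lamI ltry.
  by apply: le_measure; rewrite ?inE.
have c0 : 0 <= eta / m by rewrite divr_ge0// ltW.
have := tent_energy_ge mA Afin mv vA (ltW eta0) c0 lohi.
pose k := m - e.
have k0 : 0 < k by rewrite /k; lra.
(* On [A], a pair that is not steep is separated by [x |-> f x - m * x] at least as
much as by [x |-> (m - e) * x]. *)
have upper : (\int[lam]_x \int[lam]_y (\1_A x * \1_A y * tent eta (v x) (v y))%:E
   <= ((b - a + 2 * L) * (eta ^+ 2 / k))%:E +
     \int[lam]_x \int[lam]_y (steep f e x y * tent eta (v x) (v y))%:E)%E.
  have A0 (B : set R) x : 0 <= \1_B x :> R by rewrite indicE ler0n.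
  have -> : (((b - a + 2 * L) * (eta ^+ 2 / k))%:E =
      \int[lam]_x \int[lam]_y (\1_I x * tent eta (k * x) (k * y))%:E)%E.
    under eq_integral => x _.
      rewrite integral_mulEl ?A0//; last 2 first.
      - by rewrite /tent; measR.
      - by move=> y; exact: tent_ge0.
      rewrite (integral_tent_scaled _ (ltW eta0) k0) -EFinM; over.
    rewrite integral_mulEr//; last by rewrite divr_ge0 ?sqr_ge0// ltW.
    have -> : (\int[lam]_x (\1_I x)%:E = lam I)%E by rewrite integral_indic// setIT.
    by rewrite lamI -EFinM mulrC.
  have mI1 : measurable_fun setT (\1_I : R -> R) by [].
  have mA1 : measurable_fun setT (\1_A : R -> R) by [].
  have mtv : measurable_fun setT (fun z : R * R => tent eta (v z.1) (v z.2)).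
    by rewrite /tent; measR.
  have mtk : measurable_fun setT (fun z : R * R => tent eta (k * z.1) (k * z.2)).
    by rewrite /tent; measR.
  have ms : measurable_fun setT (fun z : R * R => steep f e z.1 z.2).
    by apply: measurable_steep => //; measR.
  rewrite -integral2_addE.
  - apply: le_integral2E.
    + by measR.
    + by measR.
    + by move=> x y; rewrite !mulr_ge0 ?tent_ge0.
    + move=> x y; rewrite !indicE.
      have [xA|xA] := boolP (x \in A); last first.
        by rewrite !mul0r addr_ge0// mulr_ge0 ?ler0n ?tent_ge0 ?steep_ge0.
      have [yA|yA] := boolP (y \in A); last first.
        by rewrite mulr0 mul0r addr_ge0// mulr_ge0 ?ler0n ?tent_ge0 ?steep_ge0.
      have /AI xI := set_mem xA; have /AI yI := set_mem yA.
      rewrite (mem_set xI) !mul1r.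
      move: xI yI; rewrite /I/= !in_itv/= => /andP[xl xr] /andP[yl yr].
      rewrite /steep /iv.
      rewrite (lt_le_trans aL0 xl) (le_lt_trans xr bL1).
      rewrite (lt_le_trans aL0 yl) (le_lt_trans yr bL1).
      rewrite !mul1r; have [_|flat] := boolP (_ < _).
        by rewrite mul1r lerDr tent_ge0.
      rewrite mul0r addr0 /tent; move: flat; rewrite -leNgt => flat.
      have : k * `|x - y| <= `|v x - v y|.
        have -> : v x - v y = (f x - f y) - m * (x - y) by rewrite /v; ring.
        rewrite [leRHS]distrC; apply: le_trans (lerB_dist _ _).
        by rewrite normrM (gtr0_norm m0) /k mulrBl lerB.
      rewrite -mulrBr normrM (gtr0_norm k0) => h.
      by rewrite ge_max !le_max lexx/= lerD2l lerN2 h orbT.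
  - by measR.
  - by measR.
  - by move=> x y; rewrite mulr_ge0 ?tent_ge0.
  - by move=> x y; rewrite mulr_ge0 ?tent_ge0 ?steep_ge0.
move=> low.
have {low} := le_trans low (leeD upper (lexx _)).
have c1 : (0 <= 2 * (eta / m) * eta)%R by apply: mulr_ge0 (ltW eta0); apply: mulr_ge0.
have h : ((2 * (eta / m) * eta * (b - a + 2 * L - 2 * e * L))%:E <=
   (2 * (eta / m) * eta)%:E * lam A)%E by rewrite EFinM lee_wpmul2l.
move=> /(le_trans h){h}.
have := @crossing_arith J M e (b - a) L m k eta J0 e0 eJ.
have -> : m * (b - a) + 4 * M - J + 2 * e * L + eta = hi - lo + eta.
  by rewrite /hi /lo /J; ring.
move=> ar h.
have {}ar := ar _ mL LM m2 e1 erefl _ (ltW M0) (ltW L0).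
have b1a : 0 <= b - a <= 1 by apply/andP; split; lra.
have eJ4 : 0 < eta <= J / 4 by rewrite eta0.
have {b1a eJ4}ar := ar b1a eJ4.
move: h; rewrite -/v.
case: (\int[lam]_x _)%E => [s| |]; last 2 first.
- by move=> _; rewrite leey.
- by [].
by rewrite -!EFinD !lee_fin; lra.
Qed.

End crossing.

(** * The weight *)

Section weight.
Context (R : realType) (w : R -> R).
Notation lam := (@lam R).
Hypothesis w_cont : continuous w.
Hypothesis w_ge0 : forall m, 0 <= w m.
Hypothesis w_gt0 : forall m, 0 < m -> 0 < w m.

Lemma measurable_weight : measurable_fun setT w.
Proof. exact: continuous_measurable_fun. Qed.

Lemma weight_bound p q : exists2 W, 0 <= W & forall m, p <= m <= q -> w m <= W.
Proof.
have [pq|qp] := leP p q; last first.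
  by exists 0 => // m /andP[? ?]; lra.
have [c _ cP] := @EVT_max R w p q pq (continuous_subspaceT w_cont).
by exists (w c) => // m mpq; apply: cP; rewrite in_itv.
Qed.

Lemma weight_lower :
  (exists2 c, 0 < c & exists N, forall m, N <= m -> c <= w m) ->
  forall e, 0 < e -> exists2 c, 0 < c & forall m, e <= m -> c <= w m.
Proof.
move=> [c c0 [N cN]] e e0.
have [eN|Ne] := leP e N; last first.
  by exists c => // m em; apply: cN; exact: le_trans (ltW Ne) em.
have [k] := @EVT_min R w e N eN (continuous_subspaceT w_cont).
rewrite in_itv/= => /andP[ek _] kP.
exists (Num.min c (w k)).
  by rewrite lt_min c0/= w_gt0// (lt_le_trans e0).
move=> m em; rewrite ge_min; have [mN|Nm] := leP m N.
  by rewrite kP ?orbT// in_itv/= em.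
by rewrite cN// ltW.
Qed.

(** Uniform continuity in multiplicative form, which is available because the
weight is bounded away from zero on compact sets of slopes. *)
Lemma weight_doubling p q : 0 < p -> exists2 delta, 0 < delta &
  forall m s, p <= m <= q -> `|m - s| <= delta -> w m <= 2 * w s.
Proof.
move=> p0.
have /compact_near_coveringP cov := @segment_compact R p q.
have := cov _ (0^'+) (fun d m => forall s, `|m - s| <= d -> w m <= 2 * w s) _.
case.
  move=> m; rewrite /= in_itv/= => /andP[pm mq].
  have wm0 : 0 < w m by apply: w_gt0; exact: lt_le_trans pm.
  have e0 : 0 < w m / 4 by rewrite divr_gt0.
  have wm : {for m, continuous w} by exact: w_cont.
  move/cvgrPdist_le : wm => /(_ _ e0).
  move=> /nbhs_ballP[r /= r0 rP].
  have r20 : 0 < r / 2 by rewrite divr_gt0.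
  exists (ball m (r / 2), [set d | d < r / 2]).
    split; first exact: nbhsx_ballx.
    by exists (r / 2) => //= d /=; rewrite sub0r normrN => dr _; apply: le_lt_trans dr; exact: ler_norm.
  move=> [m' d] /= [mm' dr] s msd.
  have /rP : ball m r m' by apply: le_ball mm'; lra.
  have /rP : ball m r s.
    rewrite /ball/=; move: mm'; rewrite /ball/= => mm'.
    have := ler_distD m' m s; lra.
  by rewrite !ler_distl => /andP[? ?] /andP[? ?]; lra.
move=> r /= r0 rP; exists (r / 2); first by rewrite divr_gt0.
move=> m s mpq ms.
have r2 : 0 < r / 2 by rewrite divr_gt0.
apply: (rP (r / 2) _ r2 m _ s ms); last by rewrite /= in_itv.
by rewrite /= sub0r normrN gtr0_norm//; lra.
Qed.

(** Discarding the slopes below [p] removes a finite amount, since the weight is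
bounded there, so finite windows above [p] still carry arbitrarily much. *)
Lemma weight_window :
  (\int[lam]_(m in `[1%R, +oo[%classic) (w m / m ^+ 2)%:E = +oo)%E ->
  forall p B, 1 <= p -> exists q,
    (B%:E <= \int[lam]_m (iv (p <= m <= q) * (w m * `|m|^-1 ^+ 2))%:E)%E.
Proof.
move=> w_int p B p1.
have mw := measurable_weight.
pose g m := w m * `|m|^-1 ^+ 2.
have mg : measurable_fun setT g by rewrite /g; measR.
have g0 m : 0 <= g m by rewrite mulr_ge0 ?exprn_ge0 ?invr_ge0.
pose u (n : nat) m := (iv (1 <= m <= n%:R) * g m)%:E.
have mu n : measurable_fun setT (u n) by rewrite /u; measR.
have u0 n m : (0 <= u n m)%E by rewrite lee_fin mulr_ge0 ?iv_ge0.
have und m : nondecreasing_seq (u^~ m).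
  move=> i j ij; rewrite lee_fin ler_wpM2r// /iv ler_nat.
  have [/andP[-> mi]|] //= := boolP (1 <= m <= i%:R).
  by rewrite (le_trans mi) ?ler_nat.
have ulim m : limn (u^~ m) = (iv (1 <= m) * g m)%:E.
  apply/cvg_lim => //; apply: cvg_near_cst; near=> n; rewrite /u.
  suff -> : m <= n%:R by rewrite andbT.
  by near: n; exact: nbhs_infty_ger.
have := monotone_convergence lam measurableT mu (fun n z _ => u0 n z)
  (fun z _ => und z).
under eq_integral do rewrite ulim.
have -> : (\int[lam]_m (iv (1 <= m) * g m)%:E = +oo)%E.
  rewrite -w_int [RHS]integral_mkcond; apply: eq_integral => m _.
  rewrite patchE mem_setE in_itv/= andbT /iv; case: (leP 1 m) => m1.
    by rewrite mul1r /g ger0_norm ?exprVn//; lra.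
  by rewrite mul0r.
move=> intE.
have nd : nondecreasing_seq (fun n => \int[lam]_m u n m)%E.
  by move=> i j ij; apply: ge0_le_integral => // z _; exact: und.
have := ereal_nondecreasing_cvgn nd => /cvg_lim.
rewrite -intE => /(_ (@ereal_hausdorff R)) supE.
have [W W0 WP] := weight_bound 1 p.
have K0 : 0 <= W * p by rewrite mulr_ge0//; lra.
have : ((B + W * p)%:E < ereal_sup (range (fun n => \int[lam]_m u n m)))%E.
  by rewrite -supE ltry.
move=> /ereal_sup_gt[_ [n _ <-] lt_n].
exists n%:R.
have : (\int[lam]_m u n m <= (W * p)%:E
    + \int[lam]_m (iv (p <= m <= n%:R) * g m)%:E)%E.
  apply: (@le_trans _ _ (\int[lam]_m (W * iv (0 <= m <= p)
      + iv (p <= m <= n%:R) * g m)%:E)%E).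
    apply: le_integralE => //.
    - by rewrite /u in mu; have /measurable_EFinP := mu n.
    - by measR.
    - by move=> m; rewrite mulr_ge0 ?iv_ge0.
    - move=> m; rewrite /iv.
      have [/andP[m1 mn]|_] := boolP (1 <= m <= n%:R); last first.
        by rewrite mul0r addr_ge0// mulr_ge0.
      rewrite mul1r; have [mp|pm] := leP m p.
        have m0 : 0 < m := lt_le_trans ltr01 m1.
        rewrite (ltW m0).
        apply: ler_wpDr; first by rewrite mulr_ge0.
        rewrite mulr1 /g; apply: le_trans (WP m _); last by rewrite m1.
        rewrite ler_piMr// expr_le1 ?invr_ge0// invf_le1 ?normr_gt0 ?gt_eqF//.
        by rewrite gtr0_norm.
      by rewrite (ltW pm) mn mul1r lerDr mulr_ge0.
  rewrite integral_addE.
  - rewrite integral_mulEl//; last by measR.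
    by rewrite (integral_iv_itv (lo := 0) (hi := p))// subr0 max_r//; lra.
  - by measR.
  - by measR.
  - by move=> m; rewrite mulr_ge0 ?iv_ge0.
  - by move=> m; rewrite mulr_ge0 ?iv_ge0.
move=> /(lt_le_trans lt_n).
case: (\int[lam]_m (iv (p <= m <= n%:R) * g m)%:E)%E => [s| |].
- by rewrite -EFinD lte_fin lee_fin; lra.
- by rewrite leey.
- by [].
Unshelve. all: by end_near. Qed.

End weight.

(** * Bounded functions of finite energy on an interval *)

Section line.
Context (R : realType) (w : R -> R).
Notation lam := (@lam R).
Hypothesis w_cont : continuous w.
Hypothesis w_ge0 : forall m, 0 <= w m.
Hypothesis w_gt0 : forall m, 0 < m -> 0 < w m.
Hypothesis w_low : exists2 c, 0 < c & exists N, forall m, N <= m -> c <= w m.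
Hypothesis w_int :
  (\int[lam]_(m in `[1%R, +oo[%classic) (w m / m ^+ 2)%:E = +oo)%E.
Implicit Types (f : R -> R) (a b e : R).

Definition line_density f x y : R := iv (0 < x < 1) * iv (0 < y < 1) *
  (w (`|f x - f y| * `|x - y|^-1) * `|x - y|^-1).

Definition line_energy f := (\int[lam]_x \int[lam]_y (line_density f x y)%:E)%E.

Lemma line_density_ge0 f x y : 0 <= line_density f x y.
Proof. by rewrite !mulr_ge0 ?iv_ge0 ?invr_ge0. Qed.

Let mw : measurable_fun setT w := measurable_weight w_cont.

Lemma measurable_line_density d (T : measurableType d) f (p q : T -> R) :
  measurable_fun setT f -> measurable_fun setT p -> measurable_fun setT q ->
  measurable_fun setT (fun z => line_density f (p z) (q z)).
Proof. by move=> mf mp mq; rewrite /line_density; measR. Qed.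

(** The weight is bounded below on slopes above [e]; this is where its inferior
limit at infinity enters. *)
Lemma steep_integrable f e : measurable_fun setT f -> 0 < e ->
  (line_energy f < +oo)%E ->
  (\int[lam]_x \int[lam]_y (steep f e x y * `|x - y|^-1)%:E < +oo)%E.
Proof.
move=> mf e0 Ffin; have [c c0 cP] := weight_lower w_cont w_gt0 w_low e0.
apply: (@le_lt_trans _ _ (c^-1%:E * line_energy f)%E); last first.
  by rewrite lte_mul_pinfty ?lee_fin ?invr_ge0 ?ltW.
rewrite -integral2_mulEl ?invr_ge0 ?(ltW c0)//; last 2 first.
- by apply: measurable_line_density; measR.
- exact: line_density_ge0.
apply: le_integral2E.
- apply: measurable_funM; last by measR.
  by apply: measurable_steep => //; measR.
- by apply: measurable_funM; [measR|apply: measurable_line_density; measR].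
- by move=> x y; rewrite mulr_ge0 ?steep_ge0 ?invr_ge0.
move=> x y; rewrite /steep /line_density -!mulrA [leRHS]mulrCA ler_wpM2l ?iv_ge0//.
rewrite [leRHS]mulrCA ler_wpM2l ?iv_ge0// mulrA ler_wpM2r ?invr_ge0//.
rewrite /iv; have [h|_] := boolP (_ < _); last by rewrite mulr_ge0// invr_ge0 ltW.
rewrite ler_pdivlMl// mulr1; apply: cP.
have [xy|xy] := eqVneq x y.
  by move: h; rewrite xy !subrr normr0 mulr0 ltxx.
by rewrite ler_pdivlMr ?normr_gt0 ?subr_eq0// ltW.
Qed.

(** At almost every [x] the function [y |-> steep f e x y / |x - y|] is integrable
for all [e] of a sequence tending to 0; its integral over [|x - y| <= l] is small
and bounds [l^-1] times the measure of the points [y] seen under a steep slope. *)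
Lemma flat_ae f : measurable_fun setT f -> (line_energy f < +oo)%E ->
  {ae lam, forall x, 0 < x < 1 -> flat_at f x}.
Proof.
move=> mf Ffin.
pose en (n : nat) : R := n.+1%:R^-1.
have en0 n : 0 < en n by rewrite invr_gt0.
pose g n x y := steep f (en n) x y * `|x - y|^-1.
have mg n : measurable_fun setT (fun z : R * R => g n z.1 z.2).
  by apply: measurable_funM; [apply: measurable_steep => //|]; measR.
have g0 n x y : 0 <= g n x y by rewrite mulr_ge0 ?steep_ge0 ?invr_ge0.
have : {ae lam, forall x, forall n, (\int[lam]_y (g n x y)%:E < +oo)%E}.
  apply: ae_foralln => n; apply: ae_lty.
  - exact: (measurable_integral2 lam (mg n)).
  - by move=> x; apply: integral_ge0 => y _; rewrite lee_fin.
  - exact: steep_integrable.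
apply: filterS => x gfin /andP[x0 x1] e e0.
have [n ne] : exists n, en n <= e by exact: exists_invS_le.
have mgx : measurable_fun setT (g n x) := measurable_curry x (mg n).
have [r r0 rP] : exists2 r, 0 < r &
    (\int[lam]_y (g n x y * iv (`|x - y| < r))%:E <= e%:E)%E.
  apply: integral_tail_small => //.
  - by measR.
  - move=> y; rewrite normr_le0 subr_eq0 => /eqP <-.
    by rewrite /g subrr normr0 invr0 mulr0.
pose r' := Num.min (r / 2) (Num.min (x / 2) ((1 - x) / 2)).
exists r'; first by rewrite !lt_min !divr_gt0// subr_gt0.
move=> l /andP[l0]; rewrite !le_min => /andP[lr /andP[lx l1]].
set B := [set y | _].
have mB : measurable B.
  by apply: measurable_set_of; measR.
have -> : lam B = (\int[lam]_y (\1_B y)%:E)%E by rewrite integral_indic// setIT.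
apply: (@le_trans _ _ (\int[lam]_y (l * (g n x y * iv (`|x - y| < r)))%:E)%E); last first.
  rewrite integral_mulEl ?(ltW l0)//; last 2 first.
  - by measR.
  - by move=> y; rewrite mulr_ge0 ?iv_ge0.
  by rewrite mulrC EFinM lee_wpmul2l// lee_fin ltW.
apply: le_integralE => //.
- by measR.
- move=> y; rewrite indicE; have [|_] := boolP (y \in B); last first.
    by rewrite !mulr_ge0 ?g0 ?iv_ge0 ?(ltW l0).
  rewrite inE /B/= => /andP[yl fyl].
  have /ler_normlP[? ?] := yl.
  have xy0 : 0 < `|x - y|.
    rewrite normr_gt0 subr_eq0; apply: contraTneq fyl => ->.
    by rewrite subrr normr0 -leNgt mulr_ge0// ltW.
  rewrite distrC in yl; rewrite distrC in fyl.
  have -> : iv (`|x - y| < r) = 1 :> R.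
    by rewrite /iv (le_lt_trans yl)//; lra.
  rewrite mulr1 /g /steep.
  have -> : 0 < y < 1 by apply/andP; split; lra.
  rewrite x0 x1 /=.
  have -> : en n * `|x - y| < `|f x - f y|.
    by apply: le_lt_trans fyl; apply: ler_pM => //; exact: ltW.
  by rewrite /iv !mul1r ler_pdivlMr// mul1r.
Qed.

(** A pair [(x, y)] sees only the [m] within [eta / |x - y|] of its slope. For a pair
at distance at least [r] these [m] are within [delta] of the slope, where doubling
replaces [w m] by the weight of the slope; for closer pairs [w m] is merely
bounded, but their total contribution is small. *)
Let inner_window f (p q eta r W delta x y e : R) :
  0 < e -> 0 < r -> 0 < eta -> 0 <= W -> 1 <= p ->
  (forall m, p <= m <= q -> w m <= W) ->
  (forall m s, p <= m <= q -> `|m - s| <= delta -> w m <= 2 * w s) ->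
  eta <= delta * r ->
  (\int[lam]_m (iv (p <= m <= q) * w m *
     (steep f e x y * tent eta (f x - m * x) (f y - m * y)))%:E <=
   (eta ^+ 2 * (4 * line_density f x y
     + 2 * W * (steep f e x y * `|x - y|^-1 * iv (`|x - y| < r))))%:E)%E.
Proof.
move=> e0 r0 eta0 W0 p1 WP dP etad.
have RHS0 : 0 <= eta ^+ 2 * (4 * line_density f x y
     + 2 * W * (steep f e x y * `|x - y|^-1 * iv (`|x - y| < r))).
  apply: mulr_ge0; first exact: sqr_ge0.
  apply: addr_ge0; apply: mulr_ge0 => //; first exact: line_density_ge0.
  - exact: mulr_ge0.
  - by rewrite mulr_ge0 ?iv_ge0// mulr_ge0 ?steep_ge0 ?invr_ge0.
have [s0|] := eqVneq (steep f e x y) 0.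
  rewrite integral0_eq ?lee_fin// => m _.
  by rewrite s0 mul0r mulr0.
rewrite {1}/steep /iv.
case: (boolP (0 < x < 1)) => x01; last by rewrite !mul0r eqxx.
case: (boolP (0 < y < 1)) => y01; last by rewrite mulr0 !mul0r eqxx.
case: (boolP (_ < _)) => steepxy; last by rewrite mulr0 eqxx.
move=> _; rewrite (_ : steep f e x y = 1); last first.
  by rewrite /steep /iv x01 y01 steepxy !mulr1.
have xy0 : 0 < `|x - y|.
  rewrite normr_gt0 subr_eq0; apply: contraTneq steepxy => ->.
  by rewrite !subrr normr0 mulr0 ltxx.
have xyN : x - y != 0 by rewrite -normr_gt0.
pose D := `|x - y|; pose s := (f x - f y) / (x - y).
have sE : `|s| = `|f x - f y| * D^-1 by rewrite /s normrM normfV.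
pose C := if D < r then W else 2 * w `|s|.
have C0 : 0 <= C by rewrite /C; case: ifP => // _; rewrite mulr_ge0.
have key m : iv (p <= m <= q) * w m * (1 * tent eta (f x - m * x) (f y - m * y))
    <= eta * C * iv (s - eta / D <= m <= s + eta / D).
  have tE : `|f x - m * x - (f y - m * y)| = D * `|s - m|.
    rewrite /D -normrM; congr `| _ |.
    by rewrite /s mulrBr mulrCA divff// mulr1; ring.
  rewrite mul1r /tent tE.
  have [near|far] := leP (`|s - m|) (eta / D); last first.
    rewrite max_l ?mulr0 ?mulr_ge0 ?iv_ge0 ?(ltW eta0)//.
    by rewrite subr_le0 mulrC -ler_pdivrMr// ltW.
  have -> : s - eta / D <= m <= s + eta / D.
    by move: near; rewrite ler_distlC => /andP[? ?]; apply/andP; split; lra.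
  rewrite /iv mulr1 [eta * C]mulrC.
  apply: ler_pM.
  - by rewrite mulr_ge0 ?ler0n.
  - by rewrite le_max lexx.
  - have [pmq|_] := boolP (p <= m <= q); last by rewrite mul0r.
    rewrite mul1r /C; case: ltP => Dr; first exact: WP.
    apply: dP => //.
    have m0 : 0 <= m by case/andP: pmq => pm _; lra.
    apply: (@le_trans _ _ `|s - m|).
      rewrite distrC -{1}(ger0_norm m0); exact: ler_dist_dist.
    apply: (le_trans near); rewrite ler_pdivrMr//; apply: (le_trans etad).
    by rewrite ler_wpM2l// -(pmulr_lge0 _ r0) (le_trans _ etad)// ltW.
  - rewrite ge_max (ltW eta0)/= gerBl mulr_ge0//; exact: ltW.
apply: (@le_trans _ _ (\int[lam]_m
    (eta * C * iv (s - eta / D <= m <= s + eta / D))%:E)%E).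
  apply: le_integralE key.
  - by rewrite /tent; measR.
  - by measR.
  - by move=> m; rewrite !mulr_ge0 ?iv_ge0 ?tent_ge0.
rewrite integral_mulEl; last 3 first.
- by rewrite mulr_ge0// ltW.
- by measR.
- by move=> m; exact: iv_ge0.
rewrite (integral_iv_itv (lo := s - eta / D) (hi := s + eta / D))//.
rewrite max_r; last first.
  have : 0 <= eta / D by rewrite divr_ge0 ?normr_ge0// ltW.
  lra.
rewrite -EFinM lee_fin /line_density x01 y01 /iv !mul1r -/D -sE.
have -> : eta * C * (s + eta / D - (s - eta / D)) = eta ^+ 2 * (2 * C * D^-1).
  by ring.
rewrite ler_wpM2l ?sqr_ge0// /C.
have Di : 0 <= D^-1 by rewrite invr_ge0 /D normr_ge0.
have wD : 0 <= w `|s| * D^-1 by rewrite mulr_ge0.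
case: ltP => Dr /=.
  by rewrite ?mul1r ?mulr1; lra.
by rewrite !mulr0 addr0; lra.
Qed.

(** Multiply the crossing energy by [w m] and integrate over a window of slopes. From
below this gives [J * eta ^ 2] times the integral of [w m / m ^ 2], hence as much as
desired; from above, at most [eta ^ 2] times a quantity depending only on the
energy. *)
Let flat_not_lt f M a b : measurable_fun setT f -> (forall x, `|f x| <= M) ->
  (line_energy f < +oo)%E -> 0 < a -> a < b -> b < 1 ->
  flat_at f a -> flat_at f b -> ~~ (f a < f b).
Proof.
move=> mf fM Ffin a0 ab b1 fa fb; apply/negP => fab.
have [e [J [m0 [eta0 [e0 J0 m01 eta00 cross]]]]] :=
  crossing_energy mf fM a0 ab b1 fa fb fab.
have F0 : (0 <= line_energy f)%E.
  exact: integral2_ge0 (line_density_ge0 f).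
have [F FE] : exists F, line_energy f = F%:E.
  by case: (line_energy f) F0 Ffin => // F _ _; exists F.
(* The value [4 * F + 2] beats the upper bound [4 * F + 1] below. *)
have [q qP] := weight_window w_cont w_ge0 w_int ((4 * F + 2) / J) m01.
have [W W0 WP] := weight_bound w_cont w_ge0 m0 q.
have [delta delta0 dP] := weight_doubling w_cont w_gt0 q (lt_le_trans ltr01 m01).
pose g x y := steep f e x y * `|x - y|^-1.
have mg : measurable_fun setT (fun z : R * R => g z.1 z.2).
  by apply: measurable_funM; [apply: measurable_steep => //|]; measR.
have g0 x y : 0 <= g x y by rewrite mulr_ge0 ?steep_ge0 ?invr_ge0.
have [r r0 rP] : exists2 r, 0 < r &
    (\int[tensor lam lam]_z (g z.1 z.2 * iv (`|z.1 - z.2| < r))%:E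
       <= ((2 * W + 1)^-1)%:E)%E.
  apply: integral_tail_small => //.
  - by measR.
  - move=> [x y]; rewrite /= normr_le0 subr_eq0 => /eqP ->.
    by rewrite /g subrr normr0 invr0 mulr0.
  - rewrite (integral_prodE lam lam (F := fun x y => (g x y)%:E)).
    + exact: steep_integrable.
    + exact/measurable_EFinP.
    + by move=> x y; rewrite lee_fin.
  - by rewrite invr_gt0; lra.
pose eta := Num.min eta0 (delta * r).
have etap : 0 < eta by rewrite lt_min eta00 mulr_gt0.
have etad : eta <= delta * r by rewrite ge_min lexx orbT.
have etae : eta <= eta0 by rewrite ge_min lexx.
pose G (m : R) (z : R * R) := iv (m0 <= m <= q) * w m *
  (steep f e z.1 z.2 * tent eta (f z.1 - m * z.1) (f z.2 - m * z.2)).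
have mG : measurable_fun setT (fun t : R * (R * R) => G t.1 t.2).
  apply: measurable_funM; first by measR.
  apply: measurable_funM; first by apply: measurable_steep => //; measR.
  by rewrite /tent; measR.
have G0 m z : 0 <= G m z by rewrite !mulr_ge0 ?iv_ge0 ?steep_ge0 ?tent_ge0.
have mGi := measurable_integral2 (tensor lam lam) mG G0.
have low : (((4 * F + 2) * eta ^+ 2)%:E
    <= \int[lam]_m \int[tensor lam lam]_z (G m z)%:E)%E.
  apply: (@le_trans _ _ (\int[lam]_m (J * eta ^+ 2 *
      (iv (m0 <= m <= q) * (w m * `|m|^-1 ^+ 2)))%:E)%E).
    rewrite integral_mulEl; last 3 first.
    - by rewrite mulr_ge0 ?sqr_ge0// ltW.
    - by measR.
    - by move=> m; rewrite mulr_ge0 ?iv_ge0// mulr_ge0// sqr_ge0.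
    have -> : (4 * F + 2) * eta ^+ 2 = J * eta ^+ 2 * ((4 * F + 2) / J).
      by field; rewrite gt_eqF.
    by rewrite EFinM lee_wpmul2l// lee_fin mulr_ge0 ?sqr_ge0// ltW.
  apply: ge0_le_integral => //.
  - move=> m _; rewrite lee_fin; apply: mulr_ge0.
      by apply: mulr_ge0; [exact: ltW|exact: sqr_ge0].
    by rewrite mulr_ge0 ?iv_ge0// mulr_ge0// sqr_ge0.
  - by measR.
  move=> m _; rewrite /G.
  under [leRHS]eq_integral do rewrite /=.
  rewrite integral_mulEl; last 3 first.
  - by rewrite mulr_ge0 ?iv_ge0.
  - apply: measurable_funM; first by apply: measurable_steep => //; measR.
    by rewrite /tent; measR.
  - by move=> z; rewrite mulr_ge0 ?steep_ge0 ?tent_ge0.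
  rewrite /iv; have [mq|_] := boolP (m0 <= m <= q); last first.
    by rewrite !mul0r mulr0 mul0e.
  rewrite !mul1r mulrCA EFinM lee_wpmul2l ?lee_fin//.
  rewrite (integral_prodE lam lam (F := fun x y =>
      (steep f e x y * tent eta (f x - m * x) (f y - m * y))%:E)); last 2 first.
  - apply/measurable_EFinP/measurable_funM.
      by apply: measurable_steep => //; measR.
    by rewrite /tent; measR.
  - by move=> x y; rewrite lee_fin mulr_ge0 ?steep_ge0 ?tent_ge0.
  case/andP: mq => m0m _.
  have m0' : 0 < m by apply: lt_le_trans m0m; exact: lt_le_trans ltr01 m01.
  apply: le_trans (cross m eta m0m _); last by rewrite etap.
  by rewrite lee_fin gtr0_norm// exprMn [leRHS]mulrA.
have up : (\int[lam]_m \int[tensor lam lam]_z (G m z)%:E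
    <= (eta ^+ 2 * (4 * F + 1))%:E)%E.
  rewrite tonelliC; last 2 first.
  - exact/measurable_EFinP.
  - by move=> m z; rewrite lee_fin.
  have mH : measurable_fun setT (fun z : R * R => eta ^+ 2 *
      (4 * line_density f z.1 z.2 + 2 * W *
        (g z.1 z.2 * iv (`|z.1 - z.2| < r)))).
    apply: measurable_funM; first by measR.
    apply: measurable_funD; last by measR.
    by apply: measurable_funM; [measR|apply: measurable_line_density; measR].
  apply: (@le_trans _ _ (\int[tensor lam lam]_z (eta ^+ 2 *
      (4 * line_density f z.1 z.2 + 2 * W *
        (g z.1 z.2 * iv (`|z.1 - z.2| < r))))%:E)%E).
    apply: ge0_le_integral => //.
    - by move=> z _; apply: integral_ge0 => m _; rewrite lee_fin.
    - apply: (measurable_partial_integral _ (F := fun z m => (G m z)%:E)).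
        apply/measurable_EFinP.
        exact: (measurableT_comp mG (measurable_fun_pair measurable_snd measurable_fst)).
      by move=> z m; rewrite lee_fin.
    - exact/measurable_EFinP.
    - by move=> z _; exact: (@inner_window f m0 q eta r W delta z.1 z.2 e e0 r0 etap W0 m01 WP dP etad).
  rewrite integral_mulEl ?sqr_ge0//; last 2 first.
  - apply: measurable_funD; last by measR.
    by apply: measurable_funM; [measR|apply: measurable_line_density; measR].
  - by move=> z; rewrite addr_ge0 ?mulr_ge0 ?line_density_ge0 ?iv_ge0.
  rewrite [leRHS]EFinM lee_wpmul2l ?lee_fin ?sqr_ge0//.
  rewrite integral_addE; last 4 first.
  - by apply: measurable_funM; [measR|apply: measurable_line_density; measR].
  - by measR.
  - by move=> z; rewrite mulr_ge0 ?line_density_ge0.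
  - by move=> z; rewrite !mulr_ge0 ?iv_ge0.
  rewrite EFinD; apply: leeD.
    rewrite integral_mulEl; last 3 first.
    - by [].
    - by apply: measurable_line_density; measR.
    - by move=> z; exact: line_density_ge0.
    rewrite (integral_prodE lam lam (F := fun x y => (line_density f x y)%:E)).
    + by rewrite -/(line_energy f) FE EFinM.
    + by apply/measurable_EFinP; apply: measurable_line_density; measR.
    + by move=> x y; rewrite lee_fin line_density_ge0.
  rewrite integral_mulEl; last 3 first.
  - by rewrite mulr_ge0.
  - by measR.
  - by move=> z; rewrite mulr_ge0 ?iv_ge0.
  apply: le_trans (lee_wpmul2l _ rP) _; first by rewrite lee_fin mulr_ge0.
  by rewrite -EFinM lee_fin ler_pdivrMr; lra.
have := le_trans low up; rewrite lee_fin mulrC ler_pM2l ?exprn_gt0//.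
by lra.
Qed.

(** Almost every point is flat, and two flat points cannot have values in strict
order; the case of a decreasing pair reduces to the opposite function. *)
Lemma line_energy_const f M : measurable_fun setT f -> (forall x, `|f x| <= M) ->
  (line_energy f < +oo)%E -> exists c, {ae lam, forall x, 0 < x < 1 -> f x = c}.
Proof.
move=> mf fM Ffin.
have flat_eq a b : 0 < a -> a < b -> b < 1 -> flat_at f a -> flat_at f b ->
    f a = f b.
  move=> a0 ab b1 fa fb.
  apply/eqP; rewrite eq_le !leNgt (flat_not_lt mf fM Ffin a0 ab b1 fa fb).
  have nd x y : `|- f x - - f y| = `|f x - f y|.
    by rewrite -opprD normrN.
  have nflat x : flat_at f x -> flat_at (\- f) x.
    move=> fx e e0; have [r r0 rP] := fx e e0; exists r => // l lr.
    by apply: le_trans (rP l lr); under eq_set do rewrite nd.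
  have nF : line_energy (\- f) = line_energy f.
    apply: eq_integral => x _; apply: eq_integral => y _.
    by rewrite /line_density nd.
  have : ~~ ((\- f) a < (\- f) b).
    apply: (@flat_not_lt (\- f) M a b _ _ _ a0 ab b1 (nflat _ fa) (nflat _ fb)).
    - by measR.
    - by move=> x; rewrite normrN.
    - by rewrite nF.
  by rewrite /= ltrN2 => ->.
have [[a a01 fa]|nofl] := pselect (exists2 a, 0 < a < 1 & flat_at f a).
  exists (f a); apply: filterS (flat_ae mf Ffin) => x xP x01.
  have fx := xP x01; case/andP: a01 => a0 a1; case/andP: x01 => x0 x1.
  have [ax|xa|->] := ltgtP a x; [|exact: flat_eq|by []].
  by rewrite (flat_eq a x).
exists 0; apply: filterS (flat_ae mf Ffin) => x xP x01.
by exfalso; apply: nofl; exists x => //; exact: xP.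
Qed.

End line.

(** * Affine changes of variables *)

Section affine_invariance.
Context (R : realType) (d : nat).
Local Notation V := 'rV[R]_d.
Local Notation leb := (@lebesgue_rV R d).
Implicit Types (t : R) (c x : V) (A : set V).

Definition affine t c x : V := t *: x + c.

Lemma affineK t c : 0 < t -> cancel (affine t c) (affine t^-1 (- (t^-1 *: c))).
Proof.
move=> t0 x; rewrite /affine scalerDr scalerA mulVf ?gt_eqF// scale1r.
by rewrite addrK.
Qed.

Lemma affineVK t c : 0 < t -> cancel (affine t^-1 (- (t^-1 *: c))) (affine t c).
Proof.
move=> t0 x; rewrite /affine scalerDr scalerN !scalerA mulfV ?gt_eqF//.
by rewrite !scale1r subrK.
Qed.

Let lebesgue_outer_affine_le t c A : 0 < t ->
  (lebesgue_outer (affine t c @^-1` A) <= (t^-1 ^+ d)%:E * lebesgue_outer A)%E.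
Proof.
move=> t0; have td0 : 0 < t^-1 ^+ d by rewrite exprn_gt0 ?invr_gt0.
rewrite muleC -lee_pdivrMr//; apply: le_ereal_inf_tmp => _ [I AI <-].
rewrite lee_pdivrMr// muleC.
pose psi := affine t^-1 (- (t^-1 *: c)).
pose J k := if I k is Some (a, b) then Some (psi a, psi b) else None.
have volJ k : (obox_vol (J k) = (t^-1 ^+ d)%:E * obox_vol (I k))%E.
  rewrite /J; case: (I k) => [[a b]|] /=; last by rewrite mule0.
  rewrite -EFinM; congr EFin; rewrite /box_vol.
  rewrite -[X in t^-1 ^+ X]card_ord -prodr_const -big_split/=.
  apply: eq_bigr => i _; rewrite !mxE opprD addrACA subrr addr0 -mulrBr.
  by rewrite maxr_pMr ?mulr0// invr_ge0 ltW.
rewrite -nneseriesZl; last by move=> *; exact: obox_vol_ge0.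
under eq_eseriesr do rewrite -volJ.
apply: ereal_inf_lbound; exists J => // x /= /AI[k _]; rewrite /affine => Ik.
exists k => //; rewrite /J; move: Ik; case: (I k) => [[a b]|] //= ab i.
have := ab i; rewrite !mxE -!mulrBr ltr_pdivrMl// ler_pdivlMl//.
by rewrite ltrBlDr lerBrDr.
Qed.

(** Boxes are stable under homotheties and translations, so the outer measure
scales; this is the only change of variables in higher dimension. *)
Lemma lebesgue_outer_affine t c A : 0 < t ->
  (lebesgue_outer (affine t c @^-1` A) = (t^-1 ^+ d)%:E * lebesgue_outer A)%E.
Proof.
move=> t0; apply/eqP; rewrite eq_le lebesgue_outer_affine_le//=.
have tV0 : 0 < t^-1 by rewrite invr_gt0.
have := lebesgue_outer_affine_le (- (t^-1 *: c)) (affine t c @^-1` A) tV0.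
rewrite (_ : _ @^-1` (_ @^-1` _) = A); last first.
  by apply/seteqP; split => x /=; rewrite affineVK.
rewrite invrK => h.
apply: (@le_trans _ _ ((t^-1 ^+ d)%:E * ((t ^+ d)%:E *
    lebesgue_outer (affine t c @^-1` A)))%E).
  by rewrite lee_wpmul2l// lee_fin exprn_ge0// ltW.
by rewrite muleA -EFinM -exprMn mulVf ?gt_eqF// expr1n mul1e.
Qed.

Lemma measurable_affine t c : 0 < t -> measurable_fun setT (affine t c).
Proof.
move=> t0 _ A mA; rewrite setTI.
have {}mA : caratheodory_measurable (@lebesgue_outer R d) A by [].
suff : caratheodory_measurable (@lebesgue_outer R d) (affine t c @^-1` A) by [].
move=> X.
have td0 : 0 <= t^-1 ^+ d by rewrite exprn_ge0// invr_ge0 ltW.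
have [Y XE] : exists Y, X = affine t c @^-1` Y.
  exists (affine t^-1 (- (t^-1 *: c)) @^-1` X).
  by apply/seteqP; split => x /=; rewrite affineK.
have E1 : X `&` affine t c @^-1` A = affine t c @^-1` (Y `&` A) by rewrite {1}XE.
have E2 : X `&` ~` (affine t c @^-1` A) = affine t c @^-1` (Y `&` ~` A).
  by rewrite {1}XE.
rewrite E1 E2 XE !lebesgue_outer_affine// (mA Y) ge0_muleDr//.
- exact: lebesgue_outer_ge0.
- exact: lebesgue_outer_ge0.
Qed.

Lemma ge0_integral_affine t c (f : V -> \bar R) : 0 < t ->
  measurable_fun setT f -> (forall x, 0 <= f x)%E ->
  (\int[leb]_x f (affine t c x) = (t^-1 ^+ d)%:E * \int[leb]_x f x)%E.
Proof.
move=> t0 mf f0.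
have td0 : 0 <= t^-1 ^+ d by rewrite exprn_ge0// invr_ge0 ltW.
have := ge0_integral_pushforward (measurable_affine c t0) leb measurableT mf.
rewrite preimage_setT => <-; last by move=> x _; exact: f0.
rewrite -(ge0_integral_mscale leb measurableT (NngNum td0))//.
apply: eq_measure_integral; first exact: measurable_affine.
by move=> mphi A mA _; exact: lebesgue_outer_affine.
Qed.

End affine_invariance.

(** * Borel versions *)

Lemma measurable_forallb d0 (T : measurableType d0) (I : finType) (b : I -> T -> bool) :
  (forall i, measurable_fun setT (b i)) ->
  measurable_fun setT (fun x => [forall i, b i x]).
Proof.
move=> mb.
rewrite (_ : (fun x => _) = (fun x => \big[andb/true]_(i <- enum I) b i x)).
  elim: (enum I) => [|i s ih]; first by under eq_fun do rewrite big_nil; exact: measurable_cst.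
  by under eq_fun do rewrite big_cons; apply: measurable_and; [exact: mb|].
by apply/funext => x; rewrite big_enum/= big_andE.
Qed.

Section borel.
Context (R : realType) (d : nat).
Local Notation V := 'rV[R]_d.
Local Notation leb := (@lebesgue_rV R d).
Implicit Types (A Q : set V).

Definition halfspaces : set (set V) :=
  [set A | exists (i : 'I_d) (c : R), A = [set x : V | x ord0 i <= c]].

(** Row vectors with the Borel sigma-algebra. The composition of a
Lebesgue-measurable function with a map such as [(x, k) |-> x + t *: k] may fail to
be measurable for the product of the Lebesgue sigma-algebras; with a Borel
function there is no such problem. *)
Definition borelV := g_sigma_algebraType halfspaces.

Lemma measurable_coord (i : 'I_d) :
  measurable_fun setT (fun x : V => x ord0 i).
Proof.
apply: (measurability _ (@RGenOInfty.measurableE R)) => //.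
move=> _ [_ [c ->] <-]; rewrite setTI.
rewrite (_ : _ @^-1` _ = ~` [set x : V | x ord0 i <= c]).
  by apply: measurableC; exact: measurable_halfspace.
by apply/seteqP; split=> x /=; rewrite in_itv/= andbT ltNge => /negP.
Qed.

Lemma measurable_coord_borel (i : 'I_d) :
  measurable_fun setT (fun x : borelV => (x : V) ord0 i).
Proof.
apply: (measurability _ (@RGenOInfty.measurableE R)) => //.
move=> _ [_ [c ->] <-]; rewrite setTI.
rewrite (_ : _ @^-1` _ = ~` [set x : borelV | (x : V) ord0 i <= c]).
  by apply: measurableC; apply: sub_sigma_algebra; exists i, c.
by apply/seteqP; split=> x /=; rewrite in_itv/= andbT ltNge => /negP.
Qed.

Lemma measurable_to_borel d0 (T : measurableType d0) (phi : T -> V) :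
  (forall i, measurable_fun setT (fun z => phi z ord0 i)) ->
  measurable_fun setT (phi : T -> borelV).
Proof.
move=> mphi; apply: (@measurability _ _ T borelV setT phi halfspaces) => //.
move=> _ [_ [i [c ->]] <-].
have := mphi i measurableT _ (measurable_itv `]-oo, c]).
by congr measurable; apply/seteqP; split=> x /=; rewrite in_itv.
Qed.

Lemma borel_measurable (A : set borelV) : measurable A -> measurable (A : set V).
Proof.
move=> mA; have := measurable_to_borel measurable_coord.
by move=> /(_ measurableT _ mA); rewrite setTI.
Qed.

Lemma borel_box (a b : V) : measurable (box a b : set borelV).
Proof.
have : measurable [set x : borelV |
    [forall i, a ord0 i < (x : V) ord0 i <= b ord0 i]].
  apply: measurable_set_of; apply: measurable_forallb => i.
  by have mi := measurable_coord_borel i; measR.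
congr measurable.
apply/seteqP; split=> x /=; first by move=> /forallP.
by move=> h; apply/forallP.
Qed.

(** Intersect the unions of covers by boxes which are optimal up to [1 / n]. *)
Lemma borel_hull A : (leb A < +oo)%E ->
  exists H : set borelV, [/\ measurable H, A `<=` H & leb H = leb A].
Proof.
move=> Afin.
have A0 : (0 <= leb A)%E by exact: lebesgue_outer_ge0.
have fA : leb A \is a fin_num by rewrite ge0_fin_numE.
have [I IP] : {I & forall n : nat, box_cover A (I n) /\
    (\sum_(k <oo) obox_vol (I n k) <= leb A + n.+1%:R^-1%:E)%E}.
  apply: (@choice _ _ (fun n J => box_cover A J /\
    (\sum_(k <oo) obox_vol (J k) <= leb A + n.+1%:R^-1%:E)%E)) => n.
  have n0 : (0 < n.+1%:R^-1 :> R) by [].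
  have [_ [J AJ <-] ltJ] := lb_ereal_inf_adherent n0 fA.
  by exists J; split => //; exact: ltW.
have mO k n : measurable (obox (I n k) : set borelV).
  by case: (I n k) => [[a b]|] /=; [exact: borel_box|exact: measurable0].
pose H : set borelV := \bigcap_n \bigcup_k (obox (I n k) : set borelV).
have mH : measurable H.
  by apply: bigcapT_measurable => n; apply: bigcupT_measurable => k.
exists H; split => //.
  by move=> x Ax n _; have [/(_ _ Ax)] := IP n.
apply/eqP; rewrite eq_le; apply/andP; split; last first.
  by apply: le_lebesgue_outer => x Ax n _; have [/(_ _ Ax)] := IP n.
apply/lee_addgt0Pr => e e0.
have [n ne] := exists_invS_le e0.
have [In sumn] := IP n.
apply: (@le_trans _ _ (\sum_(k <oo) obox_vol (I n k))%E).
  by apply: ereal_inf_lbound; exists (I n) => // x Hx; exact: Hx.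
by apply: (le_trans sumn); rewrite leeD2l// lee_fin.
Qed.

Lemma borel_null_hull A : leb A = 0%E ->
  exists H : set borelV, [/\ measurable H, A `<=` H & leb H = 0%E].
Proof.
move=> A0; have [|H [mH AH HA]] := @borel_hull A; first by rewrite A0 ltry.
by exists H; rewrite HA.
Qed.

Lemma ae_borel_null (P : V -> Prop) : {ae leb, forall x, P x} ->
  exists N : set borelV,
    [/\ measurable N, leb N = 0%E & forall x, ~ N x -> P x].
Proof.
move=> [N [mN N0 PN]]; have [H [mH NH H0]] := borel_null_hull N0.
exists H; split => // x Hx; apply: contrapT => Px.
by apply: Hx; apply: NH; exact: PN.
Qed.

(** Borel hulls of the superlevel sets of [u] at rational heights exceed them by null
sets. Outside of a Borel null set [N] containing all the excesses, the superlevel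
sets of [u] are therefore Borel, and [u] is replaced by [0] elsewhere. *)
Lemma borel_version Omega (Q : set borelV) (u : V -> R) M :
  measurable Omega -> measurable_fun Omega u -> measurable Q ->
  (leb Q < +oo)%E -> Q `<=` Omega ->
  {ae leb, forall x, Omega x -> `|u x| <= M} -> 0 <= M ->
  exists ut : V -> R, exists N : set borelV,
    [/\ measurable_fun setT (ut : borelV -> R), (forall x, `|ut x| <= M),
     measurable N, leb N = 0%E & forall x, Q x -> ~ N x -> ut x = u x].
Proof.
move=> mO mu mQ Qfin QO uM M0.
have mQ' : measurable (Q : set V) by exact: borel_measurable.
(* Rational heights; indices that encode no rational give the height 0. *)
pose rt (n : nat) : R := ratr (odflt 0 (unpickle n)).
pose A n : set V := Q `&` [set x | rt n < u x].
have mA n : measurable (A n).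
  have -> : A n = Q `&` (Omega `&` u @^-1` `]rt n, +oo[%classic).
    apply/seteqP; split=> x [Qx /=].
      by move=> h; split => //=; split; [exact: QO|rewrite in_itv/= h].
    by move=> [_]; rewrite in_itv/= andbT => h; split.
  by apply: measurableI => //; exact: mu.
have Afin n : (leb (A n) < +oo)%E.
  by apply: le_lt_trans Qfin; apply: le_lebesgue_outer => x [].
have [B BP] : {B : nat -> set borelV * set borelV & forall n,
    [/\ measurable (B n).1, measurable (B n).2, A n `<=` (B n).1,
        (B n).1 `\` A n `<=` (B n).2 & leb (B n).2 = 0%E]}.
  apply: (@choice _ _ (fun n (X : set borelV * set borelV) =>
    [/\ measurable X.1, measurable X.2, A n `<=` X.1,
        X.1 `\` A n `<=` X.2 & leb X.2 = 0%E])) => n.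
  have [H [mH AH HA]] := borel_hull (Afin n).
  have mH' : measurable (H : set V) by exact: borel_measurable.
  have HA0 : leb (H `\` A n) = 0%E.
    have fH : (leb H < +oo)%E by rewrite HA.
    transitivity (leb H - leb (A n))%E.
      rewrite (@measureD _ _ _ leb (H : set V) (A n))//.
      by rewrite (_ : _ `&` _ = A n)//; apply/setIidPr.
    by rewrite HA subee// ge0_fin_numE// lebesgue_outer_ge0.
  have [N [mN HN N0]] := borel_null_hull HA0.
  by exists (H, N); split.
have [NM [mNM NM0 NMP]] := ae_borel_null uM.
pose N : set borelV := NM `|` \bigcup_n (B n).2.
have mN : measurable N.
  by apply: measurableU => //; apply: bigcupT_measurable => n; have [] := BP n.
have N0 : leb N = 0%E.
  apply/eqP; rewrite -measure_le0.
  have sub : (leb N <= leb NM + leb (\bigcup_n (B n).2))%E.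
    by apply: outer_measureU2.
  apply: (le_trans sub); rewrite NM0 add0e.
  apply: (le_trans (@lebesgue_outer_sigma_subadditive R d (fun n => (B n).2))).
  by rewrite eseries0// => n _ _; have [] := BP n.
pose ut x : R := if pselect (Q x /\ ~ N x) is left _ then u x else 0.
exists ut, N; split => //.
- apply: (measurability _ (@RGenOInfty.measurableE R)) => //.
  move=> _ [_ [r ->] <-]; rewrite setTI.
  pose S : set borelV := \bigcup_n (if r <= rt n then (B n).1 `\` N else set0).
  have mS : measurable S.
    apply: bigcupT_measurable => n; case: ifP => _; last exact: measurable0.
    by apply: measurableD => //; have [] := BP n.
  have -> : (ut : borelV -> R) @^-1` `]r, +oo[%classic =
      S `|` (if r < 0 then ~` (Q `\` N) else set0).
    apply/seteqP; split=> x /=; rewrite in_itv/= andbT /ut.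
      case: pselect => [[Qx Nx] ru|QN r0].
        left; have [q] := rat_in_itvoo ru.
        rewrite in_itv/= => /andP[rq qu].
        exists (pickle q) => //; rewrite /rt pickleK/= (ltW rq).
        split => //; have [_ _ + _ _] := BP (pickle q); apply.
        by split => //=; rewrite /rt pickleK.
      by right; rewrite r0 => -[Qx Nx]; apply: QN.
    case=> [[n _]|].
      case: ifP => //= rn [Bx Nx].
      have [Qx rx] : A n x.
        apply: contrapT => nA; apply: Nx; right; exists n => //.
        by have [_ _ _ + _] := BP n; apply; split.
      case: pselect => [_|]; last by case.
      exact: le_lt_trans rx.
    case: ifP => [r0 QN|_ []].
    by case: pselect => [[Qx Nx]|_ //]; case: QN.
  apply: measurableU => //; case: ifP => _; last exact: measurable0.
  by apply: measurableC; apply: measurableD.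
- move=> x; rewrite /ut; case: pselect => [[Qx Nx]|_]; last by rewrite normr0.
  apply: NMP; last exact: QO.
  by move=> NMx; apply: Nx; left.
- by move=> x Qx Nx; rewrite /ut; case: pselect => // -[].
Qed.

End borel.

(** * A singular kernel, and cubes *)

Section kernel.
Context (R : realType).
Notation lam := (@lam R).
Implicit Types s t b : R.

Let integral_inv_sqr_tail s b : 0 < b ->
  (\int[lam]_t (iv (s + b <= t) * `|s - t|^-1 ^+ 2)%:E = (b^-1)%:E)%E.
Proof.
move=> b0.
pose f t := (t - s)^-1 ^+ 2; pose F t := - (t - s)^-1.
have dF x : s < x -> is_derive x 1 F (f x).
  move=> sx; have xs0 : x - s != 0 by rewrite subr_eq0 gt_eqF.
  have dxs : is_derive x 1 (fun t => t - s) 1.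
    by rewrite -[X in is_derive _ _ _ X]subr0; apply: is_deriveB.
  have dV : is_derive x 1 (fun t => (t - s)^-1) (- (x - s) ^- 2 *: 1).
    exact: is_deriveV.
  have : is_derive x 1 F (- (- (x - s) ^- 2 *: 1)) by exact: is_deriveN.
  by rewrite scaleNr opprK /f exprVn -[X in is_derive _ _ _ X -> _]/((x - s) ^- 2 * 1) mulr1.
have itvE : forall (g : R -> \bar R), (forall t, 0 <= g t)%E -> measurable_fun setT g ->
    (\int[lam]_(t in `[(s + b)%R, +oo[) g t =
     \int[lebesgue_measure]_(t in `[(s + b)%R, +oo[) g t)%E.
  move=> g g0 mg; apply: ge0_integral_lam => //.
  exact: measurable_funTS.
have mf : measurable_fun setT f.
  rewrite (_ : f = fun t => `|t - s|^-1 ^+ 2); first by measR.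
  by apply/funext => t; rewrite /f !exprVn real_normK// num_real.
have := @ge0_continuous_FTC2y R f F (s + b) 0.
rewrite -itvE; last 2 first.
- by move=> t; rewrite lee_fin sqr_ge0.
- exact/measurable_EFinP.
move=> FTC.
transitivity (\int[lam]_(t in `[(s + b)%R, +oo[) (f t)%:E)%E.
  rewrite [RHS]integral_mkcond; apply: eq_integral => t _.
  rewrite patchE mem_setE in_itv/= andbT /iv; case: (leP (s + b) t) => h.
    by rewrite mul1r /f distrC !exprVn real_normK// num_real.
  by rewrite mul0r.
have cV x : s < x -> {for x, continuous (fun t => (t - s)^-1)}.
  move=> sx; have [dFx _] := dF x sx.
  have : {for x, continuous F} by exact/differentiable_continuous/derivable1_diffP.
  rewrite (_ : (fun t => (t - s)^-1) = (fun t => - F t)).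
    by move=> cF; exact: cvgN.
  by apply/funext => t; rewrite /F opprK.
have sb x : s + b <= x -> s < x by move=> h; lra.
have sb0 : s < s + b by lra.
rewrite FTC.
- by rewrite /F sub0e -EFinN opprK [s + b]addrC addrK.
- by move=> x _; exact: sqr_ge0.
- apply: continuous_in_subspaceT => x; rewrite inE /= in_itv/= andbT => /sb/cV c.
  by rewrite /f; under eq_fun do rewrite expr2; exact: (cvgM c c).
- rewrite /F -oppr0; apply: cvgN; apply/gtr0_cvgV0.
    by near=> x; rewrite subr_gt0; near: x; apply: nbhs_pinfty_gt; rewrite num_real.
  apply/cvgryPge => A; near=> x; rewrite lerBrDr; near: x.
  by apply: nbhs_pinfty_ge; rewrite num_real.
- by move=> x sbx; have [] := dF x (sb _ (ltW sbx)).
- apply: cvg_at_right_filter; apply: cvgN; exact: cV.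
- move=> x; rewrite in_itv/= andbT => sbx; rewrite derive1E.
  by have [_ ->] := dF x (sb _ (ltW sbx)).
Unshelve. all: by end_near. Qed.

Let kernel_half s b : 0 < b ->
  (\int[lam]_t (iv (b <= t - s) * `|s - t|^-1 ^+ 2)%:E = (b^-1)%:E)%E.
Proof.
move=> b0; rewrite -(integral_inv_sqr_tail s b0); apply: eq_integral => t _.
by congr (iv _ * _)%:E; rewrite lerBrDl.
Qed.

Let kernel_sym s t b : 0 < b ->
  iv (b <= `|s - t|) * `|s - t|^-1 ^+ 2 =
  iv (b <= t - s) * `|s - t|^-1 ^+ 2 + iv (b <= s - t) * `|t - s|^-1 ^+ 2.
Proof.
move=> b0; rewrite [`|t - s|]distrC -mulrDl; congr (_ * _); rewrite /iv.
case: (lerP s t) => st.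
  have -> : b <= s - t = false by apply/negbTE; rewrite -ltNge; lra.
  by rewrite addr0.
have -> : b <= t - s = false by apply/negbTE; rewrite -ltNge; lra.
by rewrite add0r.
Qed.

Lemma integral_kernel_le b : 0 < b ->
  (\int[lam]_s \int[lam]_t (iv (0 < s < 1) * iv (0 < t < 1) *
     (iv (b <= `|s - t|) * `|s - t|^-1 ^+ 2))%:E <= (2 / b)%:E)%E.
Proof.
move=> b0.
pose k s t := iv (0 < s < 1) * (iv (b <= t - s) * `|s - t|^-1 ^+ 2).
have mk : measurable_fun setT (fun z : R * R => k z.1 z.2) by rewrite /k; measR.
have mk' : measurable_fun setT (fun z : R * R => k z.2 z.1) by rewrite /k; measR.
have k0 s t : 0 <= k s t by rewrite !mulr_ge0 ?iv_ge0 ?sqr_ge0.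
have kint : (\int[lam]_s \int[lam]_t (k s t)%:E = (b^-1)%:E)%E.
  under eq_integral => s _.
    rewrite integral_mulEl ?iv_ge0//; last 2 first.
    - by measR.
    - by move=> t; rewrite mulr_ge0 ?iv_ge0 ?sqr_ge0.
    rewrite kernel_half// -EFinM; over.
  rewrite integral_mulEr ?invr_ge0 ?(ltW b0)//; last by measR.
  rewrite (_ : (\int[lam]_s _)%E = 1%E) ?mule1//.
  rewrite (_ : (fun s => _) = (fun s => (\1_(`]0%R, 1%R[%classic) s)%:E)).
    rewrite integral_indic//= setIT lamE lebesgue_measure_itv/= lte_fin ltr01.
    by rewrite -EFinB subr0.
  by apply/funext => s; rewrite indicE mem_setE in_itv.
apply: (@le_trans _ _ (\int[lam]_s \int[lam]_t (k s t + k t s)%:E)%E).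
  apply: le_integral2E.
  - by measR.
  - by apply: measurable_funD.
  - by move=> s t; rewrite !mulr_ge0 ?iv_ge0 ?sqr_ge0.
  have iv1 c : iv c <= 1 :> R by rewrite /iv lern1 leq_b1.
  move=> s t; rewrite kernel_sym// mulrDr /k lerD//; apply: ler_wpM2r.
  - by rewrite mulr_ge0 ?iv_ge0 ?sqr_ge0.
  - by rewrite ler_piMr ?iv_ge0 ?iv1.
  - by rewrite mulr_ge0 ?iv_ge0 ?sqr_ge0.
  - by rewrite ler_piMl ?iv_ge0 ?iv1.
rewrite integral2_addE//.
have -> : (\int[lam]_s \int[lam]_t (k t s)%:E = \int[lam]_s \int[lam]_t (k s t)%:E)%E.
  rewrite tonelliC//; first exact/measurable_EFinP.
  by move=> x y; rewrite lee_fin.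
by rewrite kint -EFinD lee_fin -mulr2n mulr_natl.
Qed.

End kernel.

Section cubes.
Context (R : realType) (d : nat).
Local Notation V := 'rV[R]_d.
Implicit Types (x y c k : V) (r t : R).

(** The open ball of the sup norm, as a boolean predicate so that it can enter
integrands through [iv]. *)
Definition cube r c x : bool := [forall i, `|x ord0 i - c ord0 i| < r].

Lemma cubeP r c x : reflect (forall i, `|x ord0 i - c ord0 i| < r) (cube r c x).
Proof. exact: forallP. Qed.

Lemma cube_sym r c x : cube r c x = cube r x c.
Proof. by apply: eq_forallb => i; rewrite distrC. Qed.

Lemma le_cube r r' c x : r <= r' -> cube r c x -> cube r' c x.
Proof. by move=> rr' /cubeP xc; apply/cubeP => i; exact: lt_le_trans rr'. Qed.

Lemma cube_trans r r' x y z : cube r x y -> cube r' y z -> cube (r + r') x z.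
Proof.
move=> /cubeP xy /cubeP yz; apply/cubeP => i.
by rewrite (le_lt_trans (ler_distD (y ord0 i) _ _))// addrC ltrD.
Qed.

Lemma euclid_norm_ge0 x : 0 <= euclid_norm x.
Proof. exact: sqrtr_ge0. Qed.

Lemma coord_le_euclid_norm x i : `|x ord0 i| <= euclid_norm x.
Proof.
rewrite -sqrtr_sqr; apply: ler_wsqrtr.
by rewrite (bigD1 i)//= lerDl; apply: sumr_ge0 => j _; exact: sqr_ge0.
Qed.

Lemma euclid_norm_eq0 x : euclid_norm x = 0 -> x = 0.
Proof.
move=> x0; apply/rowP => i; rewrite mxE; apply/eqP.
by rewrite -normr_le0 -x0 coord_le_euclid_norm.
Qed.

Lemma euclid_normZ t x : euclid_norm (t *: x) = `|t| * euclid_norm x.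
Proof.
rewrite /euclid_norm -sqrtr_sqr -sqrtrM ?sqr_ge0//; congr Num.sqrt.
by rewrite mulr_sumr; apply: eq_bigr => i _; rewrite mxE exprMn.
Qed.

Lemma euclid_norm_le r x : 0 <= r -> (forall i, `|x ord0 i| <= r) ->
  euclid_norm x <= d%:R * r.
Proof.
move=> r0 xr; have dr0 : 0 <= d%:R * r by rewrite mulr_ge0.
rewrite -[leRHS]ger0_norm// -sqrtr_sqr; apply: ler_wsqrtr.
apply: (@le_trans _ _ (\sum_(i < d) r ^+ 2)).
  by apply: ler_sum => i _; rewrite -real_normK ?num_real// ler_sqr ?nnegrE.
rewrite sumr_const card_ord -[leLHS]mulr_natl [leRHS]exprMn ler_wpM2r ?sqr_ge0//.
by rewrite -natrX ler_nat; case: (d) => // n; rewrite leq_pmulr.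
Qed.

Lemma cube_add r c x : euclid_norm x < r -> cube r c (c + x).
Proof.
move=> xr; apply/cubeP => i; rewrite mxE addrAC subrr add0r.
exact: le_lt_trans (coord_le_euclid_norm x i) xr.
Qed.

Lemma cube_scale_euclid r c t k : euclid_norm k <= r -> 0 <= t < 1 ->
  0 < r -> cube r c (c + t *: k).
Proof.
move=> kr /andP[t0 t1] r0; apply: cube_add; rewrite euclid_normZ ger0_norm//.
apply: (@le_lt_trans _ _ (t * r)); last by rewrite gtr_pMl.
by rewrite ler_wpM2l.
Qed.

Lemma measurable_cube d0 (T : measurableType d0) r c (phi : T -> V) :
  (forall i, measurable_fun setT (fun z => phi z ord0 i)) ->
  measurable_fun setT (fun z => cube r c (phi z)).
Proof.
by move=> mphi; apply: measurable_forallb => i; have mi := mphi i; measR.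
Qed.

Lemma measurable_euclid_norm d0 (T : measurableType d0) (phi : T -> V) :
  (forall i, measurable_fun setT (fun z => phi z ord0 i)) ->
  measurable_fun setT (fun z => euclid_norm (phi z)).
Proof.
move=> mphi; apply: (measurableT_comp (f := @Num.sqrt R)).
  by apply: continuous_measurable_fun; exact: sqrt_continuous.
by apply: measurable_sum => i; have mi := mphi i; measR.
Qed.

End cubes.

(** * Slicing by segments *)

Section change_of_variables.
Context (R : realType) (d : nat).
Local Notation V := 'rV[R]_d.
Local Notation leb := (@lebesgue_rV R d).

Lemma integral_translate (c : V) (f : V -> \bar R) :
  measurable_fun setT f -> (forall x, 0 <= f x)%E ->
  (\int[leb]_x f (x + c)%R = \int[leb]_x f x)%E.
Proof.
move=> mf f0; have := ge0_integral_affine c ltr01 mf f0.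
rewrite invr1 expr1n mul1e => <-.
by apply: eq_integral => x _; rewrite /affine scale1r.
Qed.

Lemma integral_dilate (t : R) (f : V -> \bar R) : 0 < t ->
  measurable_fun setT f -> (forall x, 0 <= f x)%E ->
  (\int[leb]_x f (t *: x)%R = (t^-1 ^+ d)%:E * \int[leb]_x f x)%E.
Proof.
move=> t0 mf f0; rewrite -(ge0_integral_affine 0 t0 mf f0).
by apply: eq_integral => x _; rewrite /affine addr0.
Qed.

(** Measurability coordinate by coordinate: the form in which maps into [V]
enter Borel functions. *)
Definition coordm d0 (T : measurableType d0) (phi : T -> V) :=
  forall i, measurable_fun setT (fun z => phi z ord0 i).

Lemma coordm_measurable d0 (T : measurableType d0) (phi : T -> V) :
  measurable_fun setT phi -> coordm phi.
Proof. by move=> mphi i; exact: (measurableT_comp (measurable_coord i) mphi). Qed.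

Lemma coordmD d0 (T : measurableType d0) (phi psi : T -> V) :
  coordm phi -> coordm psi -> coordm (fun z => phi z + psi z).
Proof.
move=> mphi mpsi i; under eq_fun do rewrite mxE.
by apply: measurable_funD; [exact: mphi|exact: mpsi].
Qed.

Lemma coordmN d0 (T : measurableType d0) (phi : T -> V) :
  coordm phi -> coordm (fun z => - phi z).
Proof.
move=> mphi i; under eq_fun do rewrite mxE.
by apply: measurable_funN; exact: mphi.
Qed.

Lemma coordmZ d0 (T : measurableType d0) (a : T -> R) (phi : T -> V) :
  measurable_fun setT a -> coordm phi -> coordm (fun z => a z *: phi z).
Proof.
move=> ma mphi i; under eq_fun do rewrite mxE.
by apply: measurable_funM => //; exact: mphi.
Qed.

Lemma coordm_cst d0 (T : measurableType d0) (c : V) : coordm (fun _ : T => c).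
Proof. by move=> i; exact: measurable_cst. Qed.

Lemma measurable_borel_comp d0 (T : measurableType d0) (ut : V -> R) (phi : T -> V) :
  measurable_fun setT (ut : borelV R d -> R) -> coordm phi ->
  measurable_fun setT (fun z => ut (phi z)).
Proof.
move=> mut mphi.
exact: (measurableT_comp (f := (ut : borelV R d -> R)) mut (measurable_to_borel mphi)).
Qed.

End change_of_variables.

Section slicing.
Context (R : realType) (d : nat) (w : R -> R).
Local Notation V := 'rV[R]_d.
Local Notation leb := (@lebesgue_rV R d).
Local Notation lam := (@lam R).
Local Notation lebV := (leb : {sigma_finite_measure set V -> \bar R}).
Local Notation K := (tensor lebV lebV).
Local Notation S := (tensor lam lam).
Hypothesis w_cont : continuous w.
Hypothesis w_ge0 : forall m, 0 <= w m.
Hypothesis d_gt0 : (0 < d)%N.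
Context (ut : V -> R) (x0 : V) (rho : R).
Hypothesis mut : measurable_fun setT (ut : borelV R d -> R).
Hypothesis rho_gt0 : 0 < rho.

Let mw : measurable_fun setT w := measurable_weight w_cont.

Definition slope_weight (z h : V) : R := w (`|ut (z + h) - ut z| * `|euclid_norm h|^-1).

Definition pair_density (h z : V) : R :=
  iv (cube (rho + rho) x0 z) * iv (cube (rho + rho) x0 (z + h)) * slope_weight z h.

(** The function on the segment from [x] to [x + k], divided by the length of [k] so
that difference quotients in the parameter [t] are those of [ut] in space. *)
Definition slice (x k : V) (t : R) : R := ut (x + t *: k) * `|euclid_norm k|^-1.

Definition slice_density (k x : V) (s t : R) : R :=
  iv (cube rho x0 x) * iv (0 < euclid_norm k <= rho) *
  line_density w (slice x k) s t.

Lemma slope_weight_ge0 z h : 0 <= slope_weight z h.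
Proof. exact: w_ge0. Qed.

Lemma pair_density_ge0 h z : 0 <= pair_density h z.
Proof. by rewrite !mulr_ge0 ?iv_ge0 ?slope_weight_ge0. Qed.

Lemma slice_density_ge0 k x s t : 0 <= slice_density k x s t.
Proof. by rewrite !mulr_ge0 ?iv_ge0 ?line_density_ge0. Qed.

Lemma measurable_slope_weight d0 (T : measurableType d0) (p q : T -> V) :
  coordm p -> coordm q -> measurable_fun setT (fun a => slope_weight (p a) (q a)).
Proof.
move=> mp mq; have mut1 := measurable_borel_comp mut (coordmD mp mq).
have mut2 := measurable_borel_comp mut mp.
have mq' := measurable_euclid_norm mq.
by rewrite /slope_weight; measR.
Qed.

Lemma measurable_pair_density d0 (T : measurableType d0) (p q : T -> V) :
  coordm p -> coordm q -> measurable_fun setT (fun a => pair_density (p a) (q a)).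
Proof.
move=> mp mq; have m1 := measurable_slope_weight mq mp.
have m2 := measurable_cube (rho + rho) x0 mq.
have m3 := measurable_cube (rho + rho) x0 (coordmD mq mp).
by rewrite /pair_density; measR.
Qed.

Lemma measurable_slice_density d0 (T : measurableType d0) (p q : T -> V)
    (a b : T -> R) :
  coordm p -> coordm q -> measurable_fun setT a -> measurable_fun setT b ->
  measurable_fun setT (fun z => slice_density (p z) (q z) (a z) (b z)).
Proof.
move=> mp mq ma mb.
have m1 := measurable_borel_comp mut (coordmD mq (coordmZ ma mp)).
have m2 := measurable_borel_comp mut (coordmD mq (coordmZ mb mp)).
have m3 := measurable_cube rho x0 mq.
have m4 := measurable_euclid_norm mp.
by rewrite /slice_density /line_density /slice; measR.
Qed.

Let slice_densityE k x s t : s != t -> slice_density k x s t =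
  iv (0 < s < 1) * iv (0 < t < 1) * `|s - t|^-1 *
  (iv (cube rho x0 x) * iv (0 < euclid_norm k <= rho) *
   slope_weight (x + Num.min s t *: k) (`|s - t| *: k)).
Proof.
move=> st; rewrite /slice_density /line_density.
suff -> : w (`|slice x k s - slice x k t| * `|s - t|^-1) =
    slope_weight (x + Num.min s t *: k) (`|s - t| *: k) by ring.
rewrite /slope_weight /slice -mulrBl normrM normfV normr_id euclid_normZ !normrM.
rewrite !normr_id invfM -mulrA [_^-1 * _]mulrC; congr (w (_ * _)).
rewrite -addrA -scalerDl.
case: (ltrgtP s t) st => // h _; last first.
  by rewrite [(t + _)%R]addrC subrK.
by rewrite [(s + _)%R]addrC subrK distrC.
Qed.

(** For fixed times [s <> t], substitute [z = x + min s t *: k] and [h = |s - t| *: k].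
The dilation contributes [|s - t| ^- d] and the line density one more factor. *)
Let slice_fixed s t :
  (\int[K]_p (slice_density p.1 p.2 s t)%:E <=
   \int[K]_p (iv (0 < s < 1) * iv (0 < t < 1) * `|s - t|^-1 ^+ d.+1 *
      (iv (0 < euclid_norm p.1 <= rho * `|s - t|) * pair_density p.1 p.2))%:E)%E.
Proof.
have mfst : coordm (@fst V V) by apply: coordm_measurable; exact: measurable_fst.
have msnd : coordm (@snd V V) by apply: coordm_measurable; exact: measurable_snd.
have mid : coordm (@id V) by apply: coordm_measurable; exact: measurable_id.
have mcst (c : V) : coordm (fun _ : V => c) by exact: coordm_cst.
have tauX : 0 <= `|s - t|^-1 ^+ d.+1 by rewrite exprn_ge0// invr_ge0.
have triv : (forall k x, slice_density k x s t = 0) ->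
    (\int[K]_p (slice_density p.1 p.2 s t)%:E <=
     \int[K]_p (iv (0 < s < 1) * iv (0 < t < 1) * `|s - t|^-1 ^+ d.+1 *
      (iv (0 < euclid_norm p.1 <= rho * `|s - t|) * pair_density p.1 p.2))%:E)%E.
  move=> L0; rewrite [leLHS]integral0_eq => [|p _]; last by rewrite L0.
  apply: integral_ge0 => p _; rewrite lee_fin mulr_ge0//.
    by rewrite mulr_ge0// mulr_ge0 ?iv_ge0.
  by rewrite mulr_ge0 ?iv_ge0 ?pair_density_ge0.
have [st|st] := eqVneq s t.
  apply: triv => k x; rewrite /slice_density /line_density st !subrr !normr0 invr0.
  by rewrite !mulr0.
have [s01|/negP/negbTE s01] := pselect (0 < s < 1); last first.
  by apply: triv => k x; rewrite slice_densityE// s01 /iv !mul0r.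
have [t01|/negP/negbTE t01] := pselect (0 < t < 1); last first.
  by apply: triv => k x; rewrite slice_densityE// t01 /iv !(mul0r, mulr0).
clear triv tauX.
rewrite s01 t01 [iv true]/(1 : R) !mul1r.
set tau := `|s - t|; have tau0 : 0 < tau by rewrite normr_gt0 subr_eq0.
pose a := Num.min s t.
have a0 : 0 < a by case/andP: s01; case/andP: t01 => ? _ ? _; rewrite lt_min; apply/andP.
have a1 : a < 1 by case/andP: s01 => _ ?; rewrite gt_min; apply/orP; left.
have at1 : a + tau < 1.
  case/andP: s01 => _ s1; case/andP: t01 => _ t1.
  by rewrite /a /tau; case: (lerP s t) => h; rewrite addrC subrK.
pose inner h := (\int[lebV]_z (iv (0 < euclid_norm h <= rho * tau) *
    pair_density h z)%:E)%E.
have minner : measurable_fun setT inner.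
  apply: (measurable_partial_integral (T2 := V) (T3 := V) lebV (F := fun h z =>
    (iv (0 < euclid_norm h <= rho * tau) * pair_density h z)%:E)).
    have m1 := measurable_pair_density mfst msnd.
    have m2 := measurable_euclid_norm mfst.
    by apply/measurable_EFinP; apply: measurable_funM; [measR|exact: m1].
  by move=> h z; rewrite lee_fin mulr_ge0 ?iv_ge0 ?pair_density_ge0.
have inner0 h : (0 <= inner h)%E.
  by apply: integral_ge0 => z _; rewrite lee_fin mulr_ge0 ?iv_ge0 ?pair_density_ge0.
have step k : (\int[lebV]_x (slice_density k x s t)%:E <=
    (tau^-1)%:E * inner (tau *: k))%E.
  have -> : (\int[lebV]_x (slice_density k x s t)%:E =
      \int[lebV]_z (slice_density k (z - a *: k)%R s t)%:E)%E.
    rewrite (integral_translate (- (a *: k)) (f := fun x => (slice_density k x s t)%:E))//.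
      by apply/measurable_EFinP; apply: measurable_slice_density => //; measR.
    by move=> x; rewrite lee_fin slice_density_ge0.
  have mkz : coordm (fun z : V => z - a *: k).
    by apply: coordmD => //; exact: coordm_cst.
  have m1 : measurable_fun setT (fun z => pair_density (tau *: k) z).
    exact: measurable_pair_density.
  have tauV0 : 0 <= tau^-1 by rewrite invr_ge0 ltW.
  have m2 : measurable_fun setT (fun z =>
      iv (0 < euclid_norm (tau *: k) <= rho * tau) * pair_density (tau *: k) z).
    by measR.
  have p0 z : 0 <= iv (0 < euclid_norm (tau *: k) <= rho * tau) *
      pair_density (tau *: k) z.
    by rewrite mulr_ge0 ?iv_ge0 ?pair_density_ge0.
  rewrite /inner -(integral_mulEl lebV tauV0 m2 p0).
  apply: le_integralE.
  - by apply: measurable_slice_density => //; measR.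
  - by measR.
  - by move=> z; exact: slice_density_ge0.
  move=> z; rewrite slice_densityE// s01 t01 [iv true]/(1 : R) !mul1r -/tau -/a.
  rewrite ler_wpM2l ?invr_ge0 ?(ltW tau0)// subrK euclid_normZ gtr0_norm//.
  have -> : iv (0 < tau * euclid_norm k <= rho * tau) =
      iv (0 < euclid_norm k <= rho) :> R.
    by rewrite /iv pmulr_rgt0// [rho * _]mulrC ler_pM2l.
  have [xk|] := boolP (cube rho x0 (z - a *: k)); last first.
    by move=> _; rewrite /iv !mul0r mulr_ge0 ?iv_ge0 ?pair_density_ge0 ?ler0n.
  have [/andP[k0 krho]|] := boolP (0 < euclid_norm k <= rho); last first.
    by move=> _; rewrite /iv mulr0 !mul0r.
  rewrite /pair_density [iv true]/(1 : R) !mul1r.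
  have -> : cube (rho + rho) x0 z.
    rewrite -(subrK (a *: k) z); apply: cube_trans xk _.
    by apply: cube_scale_euclid => //; rewrite (ltW a0).
  have -> : cube (rho + rho) x0 (z + tau *: k).
    rewrite -(subrK (a *: k) z) -addrA -scalerDl; apply: cube_trans xk _.
    by apply: cube_scale_euclid => //; rewrite at1 addr_ge0 ?(ltW a0) ?(ltW tau0).
  by rewrite [iv true]/(1 : R) !mul1r.
rewrite (integral_prodE lebV lebV (F := fun k x => (slice_density k x s t)%:E)); last 2 first.
- by apply/measurable_EFinP; apply: measurable_slice_density => //; measR.
- by move=> k x; rewrite lee_fin slice_density_ge0.
rewrite integral_mulEl; last 3 first.
- by rewrite exprn_ge0// invr_ge0 ltW.
- have m1 := measurable_pair_density mfst msnd.
  have m2 := measurable_euclid_norm mfst.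
  by apply: measurable_funM; [measR|exact: m1].
- by move=> p; rewrite mulr_ge0 ?iv_ge0 ?pair_density_ge0.
rewrite (integral_prodE lebV lebV (F := fun h z =>
  (iv (0 < euclid_norm h <= rho * tau) * pair_density h z)%:E)); last 2 first.
- have m1 := measurable_pair_density mfst msnd.
  have m2 := measurable_euclid_norm mfst.
  by apply/measurable_EFinP; apply: measurable_funM; [measR|exact: m1].
- by move=> k x; rewrite lee_fin mulr_ge0 ?iv_ge0 ?pair_density_ge0.
rewrite exprS EFinM -muleA -(integral_dilate tau0 minner inner0).
have mtk : measurable_fun setT (fun k : V => tau *: k : V).
  rewrite (_ : (fun k : V => tau *: k : V) = affine tau 0).
    exact: measurable_affine.
  by apply/funext => k; rewrite /affine addr0.
have minnerk : measurable_fun setT (fun k : V => inner (tau *: k)).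
  exact: (measurableT_comp minner mtk).
have tauV0 : 0 <= tau^-1 by rewrite invr_ge0 ltW.
have -> : ((tau^-1)%:E * \int[lebV]_k inner (tau *: k)%R =
    \int[lebV]_k ((tau^-1)%:E * inner (tau *: k)%R))%E.
  by apply/esym; apply: ge0_integralZl_EFin.
apply: ge0_le_integral.
- exact: measurableT.
- by move=> k _; apply: integral_ge0 => x _; rewrite lee_fin slice_density_ge0.
- apply: (measurable_partial_integral (T2 := V) (T3 := V) lebV
    (F := fun k x => (slice_density k x s t)%:E)).
    by apply/measurable_EFinP; apply: measurable_slice_density => //; measR.
  by move=> k x; rewrite lee_fin slice_density_ge0.
- exact: measurable_funeM.
- by move=> k _; exact: step.
Qed.

(** The pair [(z, z + h)] is seen, at the times [s] and [t], by the segments starting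
near [z] in the direction [k = h / |s - t|]. The length of [k] is at most [rho], so
only times with [|s - t| >= |h| / rho] are involved, and the weights
[|s - t| ^- (d + 1)] of these times sum to at most [2 * (rho / |h|) ^ d], which is the
singularity of the functional. *)
Lemma slice_energy_le :
  (\int[K]_p \int[S]_q (slice_density p.1 p.2 q.1 q.2)%:E <=
   (2 * rho ^+ d)%:E *
   \int[K]_p (`|euclid_norm p.1|^-1 ^+ d * pair_density p.1 p.2)%:E)%E.
Proof.
have mfst : coordm (@fst V V) by apply: coordm_measurable; exact: measurable_fst.
have msnd : coordm (@snd V V) by apply: coordm_measurable; exact: measurable_snd.
pose M (q : R * R) (p : V * V) := iv (0 < q.1 < 1) * iv (0 < q.2 < 1) *
  `|q.1 - q.2|^-1 ^+ d.+1 *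
  (iv (0 < euclid_norm p.1 <= rho * `|q.1 - q.2|) * pair_density p.1 p.2).
have M0 q p : 0 <= M q p.
  apply: mulr_ge0; last by rewrite mulr_ge0 ?iv_ge0 ?pair_density_ge0.
  by rewrite mulr_ge0 ?exprn_ge0 ?invr_ge0// mulr_ge0 ?iv_ge0.
have mM : measurable_fun setT (fun z : (R * R) * (V * V) => M z.1 z.2).
  have m2 : coordm (fun z : (R * R) * (V * V) => z.2.1).
    by apply: coordm_measurable; exact: (measurableT_comp measurable_fst measurable_snd).
  have m3 : coordm (fun z : (R * R) * (V * V) => z.2.2).
    by apply: coordm_measurable; exact: (measurableT_comp measurable_snd measurable_snd).
  have m4 := measurable_euclid_norm m2.
  have m5 := measurable_pair_density m2 m3.
  rewrite /M; apply: measurable_funM; first by measR.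
  by apply: measurable_funM; [measR|exact: m5].
have mL : measurable_fun setT (fun z : (V * V) * (R * R) =>
    slice_density z.1.1 z.1.2 z.2.1 z.2.2).
  apply: measurable_slice_density.
  - by apply: coordm_measurable; exact: (measurableT_comp measurable_fst measurable_fst).
  - by apply: coordm_measurable; exact: (measurableT_comp measurable_snd measurable_fst).
  - exact: (measurableT_comp measurable_fst measurable_snd).
  - exact: (measurableT_comp measurable_snd measurable_snd).
rewrite (tonelliC K S (F := fun p q => (slice_density p.1 p.2 q.1 q.2)%:E)); last 2 first.
- exact/measurable_EFinP.
- by move=> p q; rewrite lee_fin slice_density_ge0.
apply: (@le_trans _ _ (\int[S]_q \int[K]_p (M q p)%:E)%E).
  apply: ge0_le_integral.
  - exact: measurableT.
  - by move=> q _; apply: integral_ge0 => p _; rewrite lee_fin slice_density_ge0.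
  - apply: (measurable_partial_integral (T2 := (V * V)%type) (T3 := (R * R)%type) K
      (F := fun q p => (slice_density p.1 p.2 q.1 q.2)%:E)).
      apply/measurable_EFinP.
      exact: (measurableT_comp mL (measurable_fun_pair measurable_snd measurable_fst)).
    by move=> q p; rewrite lee_fin slice_density_ge0.
  - exact: (measurable_integral2 (F := M) K mM M0).
  - by move=> [s t] _; exact: slice_fixed.
rewrite (tonelliC S K (F := fun q p => (M q p)%:E)); last 2 first.
- exact/measurable_EFinP.
- by move=> q p; rewrite lee_fin.
have c0 : 0 <= 2 * rho ^+ d by rewrite mulr_ge0// exprn_ge0// ltW.
have me := measurable_euclid_norm mfst.
have mp := measurable_pair_density mfst msnd.
have mN : measurable_fun setT (fun p : V * V =>
    `|euclid_norm p.1|^-1 ^+ d * pair_density p.1 p.2).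
  by apply: measurable_funM; [measR|exact: mp].
have N0 (p : V * V) : 0 <= `|euclid_norm p.1|^-1 ^+ d * pair_density p.1 p.2.
  by rewrite mulr_ge0 ?pair_density_ge0// exprn_ge0 ?invr_ge0.
rewrite -(integral_mulEl K c0 mN N0).
apply: ge0_le_integral.
- exact: measurableT.
- by move=> p _; apply: integral_ge0 => q _; rewrite lee_fin.
- apply: (measurable_partial_integral (T2 := (R * R)%type) (T3 := (V * V)%type) S
    (F := fun p q => (M q p)%:E)).
    apply/measurable_EFinP.
    exact: (measurableT_comp mM (measurable_fun_pair measurable_snd measurable_fst)).
  by move=> p q; rewrite lee_fin.
- by apply/measurable_EFinP/measurable_funM; [exact: measurable_cst|exact: mN].
move=> [h z] _; rewrite /M /=.
set g := pair_density h z; have g0 : 0 <= g by exact: pair_density_ge0.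
set nh := euclid_norm h.
have [nh0|nh0] := ltP 0 nh; last first.
  rewrite [leLHS]integral0_eq => [|q _]; last by rewrite /iv mul0r mulr0.
  by rewrite lee_fin mulr_ge0//; exact: (N0 (h, z)).
pose b := nh / rho; have b0 : 0 < b by rewrite divr_gt0.
pose ker (s t : R) := iv (0 < s < 1) * iv (0 < t < 1) *
  (iv (b <= `|s - t|) * `|s - t|^-1 ^+ 2).
have mker : measurable_fun setT (fun q : R * R => ker q.1 q.2) by rewrite /ker; measR.
have ker0 s t : 0 <= ker s t by rewrite !mulr_ge0 ?iv_ge0 ?sqr_ge0.
have bd0 : 0 <= b^-1 ^+ d.-1 by rewrite exprn_ge0// invr_ge0 ltW.
apply: (@le_trans _ _ (\int[S]_q (b^-1 ^+ d.-1 * g * ker q.1 q.2)%:E)%E).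
  apply: le_integralE.
  - by measR.
  - by measR.
  - move=> q; apply: mulr_ge0; last by rewrite mulr_ge0 ?iv_ge0.
    by rewrite mulr_ge0 ?exprn_ge0 ?invr_ge0// mulr_ge0 ?iv_ge0.
  move=> [s t]; rewrite /ker /=.
  set i1 := iv (0 < s < 1); set i2 := iv (0 < t < 1).
  have i0 : 0 <= i1 * i2 by rewrite mulr_ge0 ?iv_ge0.
  have -> : iv (nh <= rho * `|s - t|) = iv (b <= `|s - t|) :> R.
    by rewrite /b ler_pdivrMr// mulrC.
  set ti := `|s - t|^-1; set ib := iv (b <= _).
  (* All but two of the [d + 1] powers are bounded by [|s - t| >= b]. *)
  have key : ib * ti ^+ d.+1 <= b^-1 ^+ d.-1 * (ib * ti ^+ 2).
    rewrite /ib /iv; have [bst|_] := leP b `|s - t|; last by rewrite !mul0r mulr0.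
    have st0 : 0 < `|s - t| by exact: lt_le_trans bst.
    rewrite !mul1r (_ : d.+1 = d.-1 + 2)%N; last by rewrite addn2 prednK.
    rewrite exprD ler_wpM2r ?sqr_ge0// lerXn2r ?nnegrE ?invr_ge0// ?(ltW b0)//.
    by rewrite lef_pV2 ?posrE.
  have -> : i1 * i2 * ti ^+ d.+1 * (ib * g) = i1 * i2 * g * (ib * ti ^+ d.+1) by ring.
  have -> : b^-1 ^+ d.-1 * g * (i1 * i2 * (ib * ti ^+ 2)) =
    i1 * i2 * g * (b^-1 ^+ d.-1 * (ib * ti ^+ 2)) by ring.
  by rewrite ler_wpM2l// mulr_ge0.
have bg0 : 0 <= b^-1 ^+ d.-1 * g by rewrite mulr_ge0.
rewrite (integral_mulEl S bg0 mker) => [|q]; last exact: ker0.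
rewrite (integral_prodE lam lam (F := fun s t => (ker s t)%:E)); last 2 first.
- exact/measurable_EFinP.
- by move=> s t; rewrite lee_fin.
apply: (@le_trans _ _ ((b^-1 ^+ d.-1 * g)%:E * (2 / b)%:E)%E).
  by rewrite lee_wpmul2l// integral_kernel_le.
rewrite -EFinM lee_fin (gtr0_norm nh0).
rewrite [leLHS](_ : _ = 2 * (b^-1 ^+ d.-1 * b^-1) * g); last by ring.
rewrite -exprSr prednK// /b invfM invrK exprMn.
by rewrite [leLHS](_ : _ = 2 * rho ^+ d * (nh^-1 ^+ d * g))//; ring.
Qed.

End slicing.

(** * Local constancy *)

Section local_constancy.
Context (R : realType) (d : nat) (w : R -> R).
Local Notation V := 'rV[R]_d.
Local Notation leb := (@lebesgue_rV R d).
Local Notation lam := (@lam R).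
Local Notation lebV := (leb : {sigma_finite_measure set V -> \bar R}).
Local Notation K := (tensor lebV lebV).
Local Notation S := (tensor lam lam).
Hypothesis w_cont : continuous w.
Hypothesis w_ge0 : forall m, 0 <= w m.
Hypothesis w_gt0 : forall m, 0 < m -> 0 < w m.
Hypothesis w_low : exists2 c, 0 < c & exists N, forall m, N <= m -> c <= w m.
Hypothesis w_int :
  (\int[lam]_(m in `[1%R, +oo[%classic) (w m / m ^+ 2)%:E = +oo)%E.
Hypothesis d_gt0 : (0 < d)%N.
Context (ut : V -> R) (x0 : V) (rho M : R).
Hypothesis mut : measurable_fun setT (ut : borelV R d -> R).
Hypothesis ut_le : forall x, `|ut x| <= M.
Hypothesis rho_gt0 : 0 < rho.
Hypothesis energy_fin : (\int[K]_p
  (`|euclid_norm p.1|^-1 ^+ d * pair_density w ut x0 rho p.1 p.2)%:E < +oo)%E.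

(** The early and the late time of a segment are kept apart so that the displacement
[(t - s) *: k] still covers all directions and lengths up to [rho / 2]. *)
Definition jump (p : V * V) (q : R * R) : R :=
  iv (cube rho x0 p.2) * iv (0 < euclid_norm p.1 <= rho) *
  (iv (0 < q.1 < 4^-1) * iv (3 / 4 < q.2 < 1) *
   iv (ut (p.2 + q.1 *: p.1) != ut (p.2 + q.2 *: p.1))).

Let jump_ge0 p q : 0 <= jump p q.
Proof. by rewrite !mulr_ge0 ?iv_ge0. Qed.

Let measurable_jump d0 (T : measurableType d0) (k x : T -> V) (s t : T -> R) :
  coordm k -> coordm x -> measurable_fun setT s -> measurable_fun setT t ->
  measurable_fun setT (fun a => jump (k a, x a) (s a, t a)).
Proof.
move=> mk mx ms mt.
have m1 := measurable_borel_comp mut (coordmD mx (coordmZ ms mk)).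
have m2 := measurable_borel_comp mut (coordmD mx (coordmZ mt mk)).
have m3 := measurable_cube rho x0 mx.
have m4 := measurable_euclid_norm mk.
by rewrite /jump /=; measR.
Qed.

Let mjump : measurable_fun setT (fun z : (V * V) * (R * R) => jump z.1 z.2).
Proof.
rewrite (_ : (fun z => _) = (fun z : (V * V) * (R * R) =>
    jump (z.1.1, z.1.2) (z.2.1, z.2.2))); last first.
  by apply/funext => -[[k x] [s t]].
apply: measurable_jump.
- by apply: coordm_measurable; exact: (measurableT_comp measurable_fst measurable_fst).
- by apply: coordm_measurable; exact: (measurableT_comp measurable_snd measurable_fst).
- exact: (measurableT_comp measurable_fst measurable_snd).
- exact: (measurableT_comp measurable_snd measurable_snd).
Qed.

(** Almost every segment has finite line energy, hence is constant almost
everywhere. *)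
Let slice_no_jump : {ae K, forall p, (\int[S]_q (jump p q)%:E = 0)%E}.
Proof.
have msd : measurable_fun setT (fun z : (V * V) * (R * R) =>
    slice_density w ut x0 rho z.1.1 z.1.2 z.2.1 z.2.2).
  apply: measurable_slice_density => //.
  - by apply: coordm_measurable; exact: (measurableT_comp measurable_fst measurable_fst).
  - by apply: coordm_measurable; exact: (measurableT_comp measurable_snd measurable_fst).
  - exact: (measurableT_comp measurable_fst measurable_snd).
  - exact: (measurableT_comp measurable_snd measurable_snd).
pose sd p q := slice_density w ut x0 rho p.1 p.2 q.1 q.2.
have sd0 p q : 0 <= sd p q by exact: slice_density_ge0.
have : {ae K, forall p, (\int[S]_q (sd p q)%:E < +oo)%E}.
  apply: ae_lty.
  - exact: (measurable_integral2 (F := sd) S msd sd0).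
  - by move=> p; apply: integral_ge0 => q _; rewrite lee_fin.
  apply: le_lt_trans (slice_energy_le w_cont w_ge0 d_gt0 x0 mut rho_gt0) _.
  by rewrite lte_mul_pinfty ?lee_fin// mulr_ge0// exprn_ge0// ltW.
apply: filterS => -[k x] fin.
have mkx : measurable_fun setT (fun q : R * R => jump (k, x) (q.1, q.2)).
  by apply: measurable_jump; try exact: coordm_cst; measR.
have mjs s : measurable_fun setT (fun t : R => jump (k, x) (s, t)).
  by apply: measurable_jump; try exact: coordm_cst; measR.
rewrite (_ : (\int[S]_q _)%E = \int[S]_q (jump (k, x) (q.1, q.2))%:E)%E; last first.
  by apply: eq_integral => -[s t] _.
rewrite (integral_prodE lam lam (F := fun s t => (jump (k, x) (s, t))%:E)); last 2 first.
- exact/measurable_EFinP.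
- by move=> s t; rewrite lee_fin.
have [xc|xc] := boolP (cube rho x0 x); last first.
  apply: integral0_eq => s _; apply: integral0_eq => t _.
  by rewrite /jump /= (negbTE xc) /iv !mul0r.
have [kc|kc] := boolP (0 < euclid_norm k <= rho); last first.
  apply: integral0_eq => s _; apply: integral0_eq => t _.
  by rewrite /jump /= (negbTE kc) /iv mulr0 !mul0r.
have k0 : 0 < euclid_norm k by case/andP: kc.
pose f := slice ut x k.
have mf : measurable_fun setT f.
  have m1 : measurable_fun setT (fun t : R => ut (x + t *: k)).
    apply: (measurable_borel_comp mut); apply: coordmD; first exact: coordm_cst.
    by apply: coordmZ; [exact: measurable_id|exact: coordm_cst].
  by rewrite /f /slice; measR.
have fM t : `|f t| <= M * `|euclid_norm k|^-1.
  by rewrite /f /slice normrM normfV normr_id ler_wpM2r ?invr_ge0.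
have ffin : (line_energy w f < +oo)%E.
  apply: le_lt_trans fin; rewrite (integral_prodE lam lam
    (F := fun s t => (slice_density w ut x0 rho k x s t)%:E)); last 2 first.
  - apply/measurable_EFinP; apply: measurable_slice_density => //;
      try exact: coordm_cst; measR.
  - by move=> s t; rewrite lee_fin slice_density_ge0.
  rewrite le_eqVlt; apply/orP; left; apply/eqP.
  apply: eq_integral => s _; apply: eq_integral => t _.
  by rewrite /slice_density xc kc /iv !mul1r.
have [c fc] := line_energy_const w_cont w_ge0 w_gt0 w_low w_int mf fM ffin.
apply: integral_ae_eq0.
  apply: (measurable_partial_integral (T2 := R) (T3 := R) lam
    (F := fun s t => (jump (k, x) (s, t))%:E)); first exact/measurable_EFinP.
  by move=> s t; rewrite lee_fin.
apply: filterS (fc) => s fs; apply: integral_ae_eq0; first exact/measurable_EFinP.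
apply: filterS fc => t ft; rewrite /jump /=.
have [s01|] := boolP (0 < s < 4^-1); last by rewrite [iv false]/(0 : R) !mul0r mulr0.
have [t01|] := boolP (3 / 4 < t < 1); last by rewrite [iv false]/(0 : R) mulr0 mul0r mulr0.
have fst : f s = f t.
  rewrite fs ?ft//; first by case/andP: t01 => ? ?; apply/andP; split; lra.
  by case/andP: s01 => ? ?; apply/andP; split; lra.
move: fst; rewrite /f /slice => /mulIf -> //.
  by rewrite eqxx /iv !mulr0.
by rewrite invr_eq0 normr_eq0 gt_eqF.
Qed.

(** By Fubini almost every pair of times is good for almost every segment. *)
Let jump_null_times : exists s t : R,
  [/\ 0 < s < 4^-1, 3 / 4 < t < 1 & (\int[K]_p (jump p (s, t))%:E = 0)%E].
Proof.
have mJ : measurable_fun setT (fun z : (R * R) * (V * V) => jump z.2 z.1).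
  exact: (measurableT_comp mjump (measurable_fun_pair measurable_snd measurable_fst)).
have : (\int[S]_q \int[K]_p (jump p q)%:E = 0)%E.
  rewrite -(tonelliC K S (F := fun p q => (jump p q)%:E)); last 2 first.
  - exact/measurable_EFinP.
  - by move=> p q; rewrite lee_fin.
  apply: integral_ae_eq0 slice_no_jump.
  exact: (measurable_integral2 (F := jump) S mjump jump_ge0).
move=> /ae_eq0_integral => /(_ _ _)/wrap[].
- exact: (measurable_integral2 (F := fun q p => jump p q) K mJ).
- by move=> q; apply: integral_ge0 => p _; rewrite lee_fin.
move=> aeq.
pose D : set (R * R) := `]0%R, 4^-1%R[%classic `*` `](3 / 4)%R, 1%R[%classic.
have mD : measurable D by apply: measurableX; exact: measurable_itv.
have D0 : S D != 0%E.
  have -> : (S D = lam `]0%R, 4^-1%R[%classic * lam `](3 / 4)%R, 1%R[%classic)%E.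
    by apply: (product_measure1E lam lam); exact: measurable_itv.
  rewrite !lamE !lebesgue_measure_itv/= !lte_fin invr_gt0 ltr0n/=.
  rewrite ifT; last by lra.
  by rewrite -!EFinB -EFinM eqe mulf_eq0; apply/negP => /orP[] /eqP; lra.
have [[s t] [/= sD tD] st0] := ae_exists mD D0 aeq.
by rewrite !in_itv/= in sD tD; exists s, t; split.
Qed.

(** With the times fixed, [(k, x) |-> ((t - s) *: k, x + s *: k)] is a change of variables
from segments to pairs of points. *)
Let pairs_agree : (\int[lebV]_h \int[lebV]_z
  (iv (cube (rho / 2) x0 z) * iv (0 < euclid_norm h <= rho / 2) *
   iv (ut z != ut (z + h)))%:E = 0)%E.
Proof.
have [s [t [/andP[s0 s4] /andP[t3 t1] st0]]] := jump_null_times.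
pose tau := t - s; have tau0 : 0 < tau by rewrite /tau; lra.
have mfst : coordm (@fst V V) by apply: coordm_measurable; exact: measurable_fst.
have msnd : coordm (@snd V V) by apply: coordm_measurable; exact: measurable_snd.
have mid : coordm (@id V) by apply: coordm_measurable; exact: measurable_id.
pose C (h z : V) : R := iv (cube (rho / 2) x0 z) * iv (0 < euclid_norm h <= rho / 2) *
   iv (ut z != ut (z + h)).
have C0 h z : 0 <= C h z by rewrite !mulr_ge0 ?iv_ge0.
have mC d0 (T : measurableType d0) (h z : T -> V) : coordm h -> coordm z ->
    measurable_fun setT (fun a => C (h a) (z a)).
  move=> mh mz.
  have m1 := measurable_borel_comp mut mz.
  have m2 := measurable_borel_comp mut (coordmD mz mh).
  have m3 := measurable_cube (rho / 2) x0 mz.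
  have m4 := measurable_euclid_norm mh.
  by rewrite /C; measR.
pose inner h := (\int[lebV]_z (C h z)%:E)%E.
have inner0 h : (0 <= inner h)%E by apply: integral_ge0 => z _; rewrite lee_fin.
have minner : measurable_fun setT inner.
  apply: (measurable_partial_integral (T2 := V) (T3 := V) lebV
    (F := fun h z => (C h z)%:E)).
    by apply/measurable_EFinP; exact: mC.
  by move=> h z; rewrite lee_fin.
have mtk : measurable_fun setT (fun k : V => tau *: k : V).
  rewrite (_ : (fun k : V => tau *: k : V) = affine tau 0).
    exact: measurable_affine.
  by apply/funext => k; rewrite /affine addr0.
have mJ : measurable_fun setT (fun p : V * V => jump (p.1, p.2) (s, t)).
  by apply: measurable_jump => //; exact: measurable_cst.
have step k : (inner (tau *: k) <= \int[lebV]_x (jump (k, x) (s, t))%:E)%E.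
  have mCz : measurable_fun setT (fun z => C (tau *: k) z).
    by apply: mC => //; exact: coordm_cst.
  rewrite /inner -(integral_translate (s *: k) (f := fun z => (C (tau *: k) z)%:E)); last 2 first.
  - exact/measurable_EFinP.
  - by move=> z; rewrite lee_fin.
  apply: le_integralE.
  - by apply: mC; [exact: coordm_cst|apply: coordmD => //; exact: coordm_cst].
  - by apply: measurable_jump => //; try exact: coordm_cst; exact: measurable_cst.
  - by move=> x; exact: C0.
  move=> x; rewrite /C /jump /= euclid_normZ gtr0_norm//.
  have [xc|_] := boolP (cube _ _ _); last first.
    by rewrite /iv !mul0r !mulr_ge0 ?ler0n.
  have [/andP[k0 kr]|_] := boolP (0 < tau * _ <= _); last first.
    by rewrite /iv mulr0 !mul0r !mulr_ge0 ?ler0n.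
  rewrite pmulr_rgt0// in k0.
  have n0 := ltW k0.
  have krho : euclid_norm k <= rho.
    have h : 2^-1 * euclid_norm k <= tau * euclid_norm k.
      by rewrite ler_wpM2r// /tau; lra.
    lra.
  have -> : cube rho x0 x.
    have skr : euclid_norm (s *: k) < rho / 2.
      rewrite euclid_normZ gtr0_norm//.
      have : s * euclid_norm k <= 4^-1 * rho by apply: ler_pM => //; exact: ltW.
      by move: rho_gt0; lra.
    have := cube_add x skr; rewrite cube_sym => /(cube_trans xc).
    by rewrite -splitr.
  rewrite k0 krho s0 s4 t3 t1 [iv true]/(1 : R) !mul1r -addrA -scalerDl.
  by rewrite /tau [s + _]addrC subrK.
have : (\int[lebV]_k inner (tau *: k)%R = 0)%E.
  apply/eqP; rewrite eq_le; apply/andP; split; last first.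
    by apply: integral_ge0 => k _; exact: inner0.
  rewrite -st0 [leRHS](_ : _ = \int[K]_p (jump (p.1, p.2) (s, t))%:E)%E; last first.
    by apply: eq_integral => -[k x] _.
  rewrite (integral_prodE lebV lebV (F := fun k x => (jump (k, x) (s, t))%:E)); last 2 first.
  - exact/measurable_EFinP.
  - by move=> k x; rewrite lee_fin.
  apply: ge0_le_integral.
  - exact: measurableT.
  - by move=> k _; exact: inner0.
  - exact: (measurableT_comp minner mtk).
  - apply: (measurable_partial_integral (T2 := V) (T3 := V) lebV
      (F := fun k x => (jump (k, x) (s, t))%:E)); first exact/measurable_EFinP.
    by move=> k x; rewrite lee_fin.
  - by move=> k _; exact: step.
rewrite (integral_dilate tau0 minner inner0) => /eqP; rewrite mule_eq0 => /orP[|/eqP//].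
by rewrite eqe expf_eq0 invr_eq0 gt_eqF// andbF.
Qed.

(** The function agrees at almost every pair of close points, so almost every point
[z] of the small cube has the value of almost every other point; any such [z]
provides the constant. The side is chosen so that two points of the small cube
are within Euclidean distance [rho / 2], at most [d] times their sup distance. *)
Lemma ae_constant_on_cube :
  exists c, {ae leb, forall y, cube (rho / (4 * d%:R)) x0 y -> ut y = c}.
Proof.
have mfst : coordm (@fst V V) by apply: coordm_measurable; exact: measurable_fst.
have msnd : coordm (@snd V V) by apply: coordm_measurable; exact: measurable_snd.
have mid : coordm (@id V) by apply: coordm_measurable; exact: measurable_id.
pose C (h z : V) : R := iv (cube (rho / 2) x0 z) * iv (0 < euclid_norm h <= rho / 2) *
   iv (ut z != ut (z + h)).
have C0 h z : 0 <= C h z by rewrite !mulr_ge0 ?iv_ge0.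
have mC d0 (T : measurableType d0) (h z : T -> V) : coordm h -> coordm z ->
    measurable_fun setT (fun a => C (h a) (z a)).
  move=> mh mz.
  have m1 := measurable_borel_comp mut mz.
  have m2 := measurable_borel_comp mut (coordmD mz mh).
  have m3 := measurable_cube (rho / 2) x0 mz.
  have m4 := measurable_euclid_norm mh.
  by rewrite /C; measR.
have : (\int[lebV]_z \int[lebV]_h (C h z)%:E = 0)%E.
  rewrite -(tonelliC lebV lebV (F := fun h z => (C h z)%:E)).
  - exact: pairs_agree.
  - by apply/measurable_EFinP; exact: mC.
  - by move=> h z; rewrite lee_fin.
move=> /ae_eq0_integral => /(_ _ _)/wrap[].
- apply: (measurable_partial_integral (T2 := V) (T3 := V) lebV
    (F := fun z h => (C h z)%:E)).
    by apply/measurable_EFinP; exact: mC.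
  by move=> h z; rewrite lee_fin.
- by move=> z; apply: integral_ge0 => h _; rewrite lee_fin.
move=> aez.
set r := rho / (4 * d%:R).
have d0 : 0 < d%:R :> R by rewrite ltr0n.
have d1 : 1 <= d%:R :> R by rewrite ler1n.
have dr : d%:R * (r + r) = rho / 2 by rewrite /r; field; rewrite gt_eqF.
have r0 : 0 < r by rewrite divr_gt0// mulr_gt0.
have rrho : r <= rho / 2 by nra.
have [[z zr Cz]|noz] := pselect (exists2 z, cube r x0 z &
    (\int[lebV]_h (C h z)%:E = 0)%E); last first.
  exists 0; apply: filterS aez => z Cz zr.
  by exfalso; apply: noz; exists z.
exists (ut z).
have mCz : measurable_fun setT (fun h => C h z).
  by apply: mC => //; exact: coordm_cst.
have := integral_translate (- z) (f := fun h => (C h z)%:E).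
rewrite Cz => /(_ _ _)/wrap[].
- exact/measurable_EFinP.
- by move=> h; rewrite lee_fin.
move=> /ae_eq0_integral => /(_ _ _)/wrap[].
- apply/measurable_EFinP; apply: mC; last exact: coordm_cst.
  by apply: coordmD => //; exact: coordm_cst.
- by move=> h; rewrite lee_fin.
apply: filterS => y /eqP; rewrite eqe /C subrKC => Cy yr.
have [->//|yz] := eqVneq y z.
move: Cy; rewrite (le_cube rrho zr) [iv true]/(1 : R) mul1r.
have -> : 0 < euclid_norm (y - z).
  rewrite lt_neqAle euclid_norm_ge0 andbT eq_sym; apply: contraNneq yz.
  by move=> /euclid_norm_eq0/eqP; rewrite subr_eq0.
have -> : euclid_norm (y - z) <= rho / 2.
  rewrite -dr; apply: euclid_norm_le; first by rewrite addr_ge0// ltW.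
  move=> i; rewrite !mxE; rewrite cube_sym in zr.
  by have /cubeP/(_ i) := cube_trans zr yr; exact: ltW.
by rewrite mul1r; apply: contraTeq; rewrite eq_sym => ->; rewrite /iv oner_eq0.
Qed.

End local_constancy.

(** * Gluing along a connected open set *)

Section gluing.
Context (R : realType) (d : nat).
Local Notation V := 'rV[R]_d.
Local Notation leb := (@lebesgue_rV R d).
Implicit Types (x y : V) (r : R) (Omega : set V).

Lemma open_cube Omega x : open Omega -> Omega x ->
  exists2 r, 0 < r & forall y, cube r x y -> Omega y.
Proof.
move=> oO Ox; have : nbhs x Omega by exact: open_nbhs_nbhs.
move=> /nbhs_ballP[r /= r0 rO]; exists r => // y /cubeP xy.
by apply: rO; split => // i j; rewrite ord1 /ball/= distrC.
Qed.

Lemma cube_open (P : set V) :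
  (forall x, P x -> exists2 r, 0 < r & forall y, cube r x y -> P y) -> open P.
Proof.
move=> Pcube; rewrite openE => x /Pcube[r r0 rP].
apply/nbhs_ballP; exists r => //= y xy; apply: rP; apply/cubeP => i.
by have [_ /(_ ord0 i)] := xy; rewrite /ball/= distrC.
Qed.

Let rcube (an : 'rV[rat]_d * nat) y : bool :=
  cube (an.2.+1%:R^-1) (map_mx ratr an.1) y.

Let rational_cube x r : 0 < r -> exists an,
  rcube an x /\ forall y, rcube an y -> cube r x y.
Proof.
move=> r0.
have [n nr] : exists n : nat, n.+1%:R^-1 <= r / 2.
  by apply: exists_invS_le; rewrite divr_gt0.
have n0 : 0 < n.+1%:R^-1 :> R by rewrite invr_gt0.
have [a aP] : {a : 'I_d -> rat & forall i,
    ratr (a i) \in `]x ord0 i, (x ord0 i + n.+1%:R^-1)[}.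
  apply: (@choice _ _ (fun i q => ratr q \in `]x ord0 i, (x ord0 i + n.+1%:R^-1)[)).
  by move=> i; apply: rat_in_itvoo; rewrite ltrDl.
exists (\row_i a i, n).
have xa : rcube (\row_i a i, n) x.
  apply/cubeP => i; rewrite !mxE distrC ltr_norml.
  have := aP i; rewrite in_itv/= => /andP[h1 h2].
  move: n0 h2; set e := n.+1%:R^-1 => n0 h2; apply/andP; split; lra.
split=> // y ya; rewrite /rcube cube_sym in xa.
by apply: le_cube (cube_trans xa ya); rewrite [r]splitr lerD.
Qed.

Lemma measurable_cube_set r x : measurable [set y : V | cube r x y].
Proof.
by apply: measurable_set_of; apply: measurable_cube; exact: measurable_coord.
Qed.

Let mrcube an : measurable [set y : V | rcube an y].
Proof. exact: measurable_cube_set. Qed.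

(** Rational cubes form a countable base of the topology. *)
Lemma open_measurable_rV Omega : open Omega -> measurable Omega.
Proof.
move=> oO.
pose F k := if unpickle k is Some an then
  (if `[< forall y, rcube an y -> Omega y >] then [set y : V | rcube an y] else set0)
  else set0.
have -> : Omega = \bigcup_k F k.
  apply/seteqP; split=> x.
    move=> Ox; have [r r0 rO] := open_cube oO Ox.
    have [an [xa anr]] := rational_cube x r0.
    exists (pickle an) => //; rewrite /F pickleK ifT//.
    by apply/asboolP => y /anr; exact: rO.
  move=> [k _]; rewrite /F; case: (unpickle k) => // an.
  by case: ifPn => // /asboolP; exact.
apply: bigcupT_measurable => k; rewrite /F; case: (unpickle k) => // an.
by case: ifP.
Qed.

(** Lindelof: countably many rational cubes suffice, so a property that holds
almost everywhere near each point of a set holds almost everywhere on it. *)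
Lemma ae_glue Omega (P : V -> Prop) :
  (forall x, Omega x -> exists2 r, 0 < r & {ae leb, forall y, cube r x y -> P y}) ->
  {ae leb, forall y, Omega y -> P y}.
Proof.
move=> locP.
pose Q k y := if unpickle k is Some an then
  ({ae leb, forall y, rcube an y -> P y} -> rcube an y -> P y) else True.
have : {ae leb, forall y, forall k, Q k y}.
  apply: ae_foralln => k; rewrite /Q; case: (unpickle k) => [an|]; last exact: aeW.
  have [h|h] := pselect {ae leb, forall y, rcube an y -> P y}.
    by apply: filterS h => y Py _.
  exact: aeW.
apply: filterS => y Qy Oy; have [r r0 rP] := locP y Oy.
have [an [ya anr]] := rational_cube y r0.
have := Qy (pickle an); rewrite /Q pickleK; apply => //.
by apply: filterS rP => z Pz /anr; exact: Pz.
Qed.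

(** If one cube is null then so are its translates, hence the whole space. *)
Lemma null_cube_ae x r : 0 < r -> leb [set y | cube r x y] = 0%E ->
  forall P : V -> Prop, {ae leb, forall y, P y}.
Proof.
move=> r0 x0 P.
have : {ae leb, forall y, setT y -> P y}.
  apply: ae_glue => z _; exists r => //.
  exists [set y | cube r z y]; split.
  - exact: measurable_cube_set.
  - have := lebesgue_outer_affine (x - z) [set y | cube r x y] ltr01.
    rewrite -[lebesgue_outer _ in RHS]/(leb _) x0 mule0 => <-.
    congr lebesgue_outer; apply/seteqP; split=> y /= /cubeP zy; apply/cubeP => i;
      have := zy i; rewrite /affine scale1r !mxE; congr (`| _ | < r); ring.
  - by move=> y /= /not_implyP[].
by apply: filterS => y; exact.
Qed.

(** The constants near two points agree if the cubes around the points overlap, since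
cubes have positive measure. Hence the points with a given local constant form an
open set, and so do the points with any other one. *)
Lemma connected_ae_constant Omega (u : V -> R) :
  open Omega -> connected Omega ->
  (forall x, Omega x -> exists c, exists2 r, 0 < r &
    {ae leb, forall y, cube r x y -> u y = c}) ->
  exists c, {ae leb, forall y, Omega y -> u y = c}.
Proof.
move=> oO cO loc.
have [[x [r [r0 xr0]]]|pos] :=
  pselect (exists x r, 0 < r /\ leb [set y | cube r x y] = 0%E).
  by exists 0; exact: null_cube_ae xr0 _.
have [[x1 Ox1]|noO] := pselect (exists x, Omega x); last first.
  by exists 0; apply: aeW => y Oy; exfalso; apply: noO; exists y.
pose near_const c x := exists2 r, 0 < r & {ae leb, forall y, cube r x y -> u y = c}.
have uniq c c' x : near_const c x -> near_const c' x -> c = c'.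
  move=> [r r0 rc] [r' r'0 rc']; apply: contrapT => cc'; apply: pos.
  exists x, (Num.min r r'); split; first by rewrite lt_min r0.
  apply: (measure_negligible (measurable_cube_set _ _)).
  have : {ae leb, forall y, ~ cube (Num.min r r') x y}.
    apply: filterS2 rc rc' => y uc uc' yr; apply: cc'.
    by rewrite -uc ?uc'//; apply: le_cube yr; rewrite ge_min lexx ?orbT.
  by apply: negligibleS => y /= yr; apply.
have near_open c : forall x, near_const c x ->
    exists2 r, 0 < r & forall y, cube r x y -> near_const c y.
  move=> x [r r0 rc]; exists (r / 2); first by rewrite divr_gt0.
  move=> y xy; exists (r / 2); first by rewrite divr_gt0.
  apply: filterS rc => z rz yz; apply: rz.
  by rewrite [r]splitr; exact: cube_trans yz.
have [c0 Pc0] := loc _ Ox1.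
exists c0; apply: ae_glue => x Ox.
suff BO : Omega `&` [set x | near_const c0 x] = Omega.
  by have [_] : (Omega `&` [set x | near_const c0 x]) x by rewrite BO.
apply: cO.
- by exists x1.
- by exists [set x | near_const c0 x] => //; exact: cube_open (near_open c0).
exists (~` [set x | exists2 c, c != c0 & near_const c x]).
  apply: open_closedC; apply: cube_open => y [c cc0 /near_open[s s0 sc]].
  by exists s => // z /sc ?; exists c.
apply/seteqP; split=> y [Oy].
  by move=> yc0; split => // -[c cc0 yc]; move/eqP: cc0; apply; exact: uniq yc yc0.
move=> yc; split => //; have [c cP] := loc y Oy.
have [cc0|/eqP cc0] := eqVneq c c0; first by rewrite -cc0.
by exfalso; apply: yc; exists c => //; apply/eqP.
Qed.

End gluing.

(** * From the functional to Borel functions on cubes *)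

Section even_extension.
Context (R : realType) (omega : R -> R).

(** Composition with the absolute value turns a weight on the half-line into a
continuous function on the whole line with the same values on slopes. *)
Lemma continuous_even_extension :
  {within `[0, +oo[%classic, continuous omega} -> continuous (fun m : R => omega `|m|).
Proof.
move=> /subspace_continuousP oc x.
have x0 : `[0%R, +oo[%classic `|x| by rewrite /= in_itv/= normr_ge0.
have nc : continuous (fun y : R => `|y|) by exact: (@norm_continuous R R).
have nw : (fun y : R => `|y|) @ x --> within `[0%R, +oo[%classic (nbhs `|x|).
  move=> A An; have : nbhs x (fun y => `[0%R, +oo[%classic `|y| -> A `|y|) := nc x _ An.
  apply: (@filterS _ (nbhs x)) => y; apply.
  by rewrite /= in_itv/= andbT normr_ge0.
exact: cvg_comp nw (oc _ x0).
Qed.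

Lemma liminf_gt0_lower_bound :
  (0 < limf_einf (EFin \o omega) (pinfty_nbhs R))%E ->
  exists2 c, 0 < c & exists N, forall m, N <= m -> c <= omega `|m|.
Proof.
rewrite limf_einfE => /ereal_sup_gt[_ [A [N [_ NA]] <-]] infA.
have [c c0 cinf] : exists2 c : R, 0 < c & (c%:E <= ereal_inf ((EFin \o omega) @` A))%E.
  case: (ereal_inf _) infA => [c| |]//; first by rewrite lte_fin => ?; exists c.
  by move=> _; exists 1 => //; rewrite leey.
exists c => //; exists (Num.max 0 N + 1) => m Nm.
have /andP[m0 mN] : (0 < m) && (N < m).
  by rewrite -gt_max (lt_le_trans _ Nm)// ltrDl.
rewrite gtr0_norm// -lee_fin (le_trans cinf)//.
by apply: ereal_inf_lbound; exists m => //; exact: NA.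
Qed.

End even_extension.

Section energy.
Context (R : realType) (d : nat) (w : R -> R).
Local Notation V := 'rV[R]_d.
Local Notation leb := (@lebesgue_rV R d).
Local Notation lebV := (leb : {sigma_finite_measure set V -> \bar R}).
Local Notation K := (tensor lebV lebV).
Hypothesis w_cont : continuous w.
Hypothesis w_ge0 : forall m, 0 <= w m.

Let mw : measurable_fun setT w := measurable_weight w_cont.

Definition density (u : V -> R) (x y : V) : R :=
  w (`|u y - u x| * `|euclid_norm (y - x)|^-1) * `|euclid_norm (y - x)|^-1 ^+ d.

Let density_ge0 u x y : 0 <= density u x y.
Proof. by rewrite mulr_ge0// exprn_ge0// invr_ge0. Qed.

Let mnorm : measurable_fun setT (fun z : V * V => euclid_norm (z.2 - z.1)).
Proof.
apply: measurable_euclid_norm; apply: coordmD; last apply: coordmN.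
  by apply: coordm_measurable; exact: measurable_snd.
by apply: coordm_measurable; exact: measurable_fst.
Qed.

Let measurable_density (u : V -> R) :
  measurable_fun setT (fun z : V * V => u z.1) ->
  measurable_fun setT (fun z : V * V => u z.2) ->
  measurable_fun setT (fun z : V * V => density u z.1 z.2).
Proof. by move=> m1 m2; have m3 := mnorm; rewrite /density; measR. Qed.

Lemma F_functionalE (u : V -> R) (Omega : set V) :
  F_functional w u Omega =
  (\int[leb \x leb]_z (iv (z.1 \in Omega) * iv (z.2 \in Omega) *
     density (u \_ Omega) z.1 z.2)%:E)%E.
Proof.
rewrite /F_functional integral_mkcond; apply: eq_integral => -[x y] _.
rewrite !patchE; have -> : ((x, y) \in Omega `*` Omega) = (x \in Omega) && (y \in Omega).
  by apply/idP/andP; rewrite !inE.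
case: (boolP (x \in Omega)) => xO; last by rewrite /iv !mul0r.
case: (boolP (y \in Omega)) => yO; last by rewrite /iv mulr0 mul0r.
rewrite /iv !mul1r /density !patchE xO yO /=.
by rewrite (ger0_norm (euclid_norm_ge0 _)) exprVn.
Qed.

(** Substitute [h = y - x] in the functional; replacing [u] by [ut] only affects pairs in
[N `*` setT] or [setT `*` N], which are null. *)
Lemma cube_energy_fin (u ut : V -> R) (Omega : set V) (N : set (borelV R d))
    (x0 : V) (rho : R) :
  measurable Omega -> measurable_fun Omega u ->
  measurable_fun setT (ut : borelV R d -> R) ->
  measurable N -> leb N = 0%E ->
  (forall x, cube (rho + rho) x0 x -> Omega x) ->
  (forall x, cube (rho + rho) x0 x -> ~ N x -> ut x = u x) ->
  (F_functional w u Omega < +oo)%E ->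
  (\int[K]_p (`|euclid_norm p.1|^-1 ^+ d * pair_density w ut x0 rho p.1 p.2)%:E
    < +oo)%E.
Proof.
move=> mO mu mut mN N0 cO utu.
apply: le_lt_trans; rewrite F_functionalE.
have mfst : coordm (@fst V V) by apply: coordm_measurable; exact: measurable_fst.
have msnd : coordm (@snd V V) by apply: coordm_measurable; exact: measurable_snd.
have mid : coordm (@id V) by apply: coordm_measurable; exact: measurable_id.
have mN' : measurable (N : set V) by exact: borel_measurable.
pose Q := cube (rho + rho) x0.
pose H (h z : V) : R := `|euclid_norm h|^-1 ^+ d * pair_density w ut x0 rho h z.
have H0 h z : 0 <= H h z.
  by rewrite mulr_ge0 ?pair_density_ge0// exprn_ge0// invr_ge0.
have mH d0 (T : measurableType d0) (h z : T -> V) : coordm h -> coordm z ->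
    measurable_fun setT (fun a => H (h a) (z a)).
  move=> mh mz; have m1 := measurable_pair_density w_cont x0 rho mut mh mz.
  have m2 := measurable_euclid_norm mh.
  by apply: measurable_funM; [measR|exact: m1].
have -> : (\int[K]_p (H p.1 p.2)%:E =
    \int[K]_z (iv (Q z.1) * iv (Q z.2) * density ut z.1 z.2)%:E)%E.
  rewrite (integral_prodE lebV lebV (F := fun h z => (H h z)%:E)); last 2 first.
  - by apply/measurable_EFinP; exact: mH.
  - by move=> h z; rewrite lee_fin.
  rewrite tonelliC; last 2 first.
  - by apply/measurable_EFinP; exact: mH.
  - by move=> h z; rewrite lee_fin.
  have HE x y : H (y - x) x = iv (Q x) * iv (Q y) * density ut x y.
    by rewrite /H /pair_density /slope_weight /density /Q [x + _]addrC subrK; ring.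
  rewrite (integral_prodE lebV lebV
    (F := fun x y => (iv (Q x) * iv (Q y) * density ut x y)%:E)); last 2 first.
  - apply/measurable_EFinP.
    rewrite (_ : (fun z => _) = (fun z : V * V => H (z.2 - z.1) z.1)).
      by apply: mH => //; apply: coordmD => //; exact: coordmN.
    by apply/funext => z; rewrite HE.
  - by move=> x y; rewrite lee_fin mulr_ge0// mulr_ge0 ?iv_ge0.
  apply: eq_integral => x _.
  rewrite -(integral_translate (- x) (f := fun h => (H h x)%:E)).
  - by apply: eq_integral => y _; rewrite HE.
  - by apply/measurable_EFinP; apply: mH => //; exact: coordm_cst.
  - by move=> h; rewrite lee_fin.
pose u0 := u \_ Omega.
have mu0 : measurable_fun setT u0 by apply/(measurable_restrictT u).
have m1 := measurableT_comp mu0 (@measurable_fst _ _ V V).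
have m2 := measurableT_comp mu0 (@measurable_snd _ _ V V).
have mD0 := measurable_density m1 m2.
have mut1 := measurable_borel_comp mut mfst.
have mut2 := measurable_borel_comp mut msnd.
have mDt := measurable_density mut1 mut2.
have mO1 : measurable_fun setT (fun z : V => iv (z \in Omega) : R).
  rewrite (_ : (fun z : V => _) = \1_Omega); first exact: measurable_indic.
  by apply/funext => z; rewrite indicE.
have mOf := measurableT_comp mO1 (@measurable_fst _ _ V V).
have mOs := measurableT_comp mO1 (@measurable_snd _ _ V V).
have mQ1 := measurable_cube (rho + rho) x0 mfst.
have mQ2 := measurable_cube (rho + rho) x0 msnd.
apply: ae_ge0_le_integral.
- exact: measurableT.
- by move=> z _; rewrite lee_fin mulr_ge0// mulr_ge0 ?iv_ge0.
- by apply/measurable_EFinP; apply: measurable_funM; [measR|exact: mDt].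
- by move=> z _; rewrite lee_fin mulr_ge0// mulr_ge0 ?iv_ge0.
- apply/measurable_EFinP; apply: measurable_funM; last exact: mD0.
  by apply: measurable_funM; [exact: mOf|exact: mOs].
have NT : K ((N : set V) `*` setT) = 0%E.
  rewrite (_ : K _ = leb N * leb setT)%E; first by rewrite N0 mul0e.
  by apply: (product_measure1E lebV lebV).
have TN : K (setT `*` (N : set V)) = 0%E.
  rewrite (_ : K _ = leb setT * leb N)%E; first by rewrite N0 mule0.
  by apply: (product_measure1E lebV lebV).
exists (((N : set V) `*` setT) `|` (setT `*` (N : set V))); split.
- by apply: measurableU; apply: measurableX.
- by apply: null_set_setU => //; apply: measurableX.
move=> [x y] /= /not_implyP[_ bad].
have [Nx|Nx] := pselect (N x); first by left.
have [Ny|Ny] := pselect (N y); first by right.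
exfalso; apply: bad; rewrite lee_fin.
have [Qx|_] := boolP (Q x); last by rewrite [iv false]/(0 : R) !mul0r mulr_ge0// mulr_ge0 ?iv_ge0.
have [Qy|_] := boolP (Q y); last first.
  by rewrite [iv false]/(0 : R) mulr0 mul0r mulr_ge0// mulr_ge0 ?iv_ge0.
have Ox := cO _ Qx; have Oy := cO _ Qy.
rewrite (mem_set Ox) (mem_set Oy) /density /u0 !patchE (mem_set Ox) (mem_set Oy).
by rewrite !utu.
Qed.

End energy.

Section bounded_cube.
Context (R : realType) (d : nat).
Local Notation V := 'rV[R]_d.
Local Notation leb := (@lebesgue_rV R d).

Lemma measurable_cube_borel r (x : V) :
  measurable [set y : borelV R d | cube r x (y : V)].
Proof.
by apply: measurable_set_of; apply: measurable_cube; exact: measurable_coord_borel.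
Qed.

Lemma cube_finite r (x : V) : (leb [set y | cube r x y] < +oo)%E.
Proof.
apply: le_lt_trans (ltry (box_vol (x - const_mx r) (x + const_mx r))).
apply: le_trans (lebesgue_rV_box_le _ _); apply: le_lebesgue_outer.
move=> y /cubeP xy i; rewrite !mxE; have := xy i; rewrite ltr_norml => /andP[h1 h2].
by apply/andP; split; lra.
Qed.

Lemma F_functional_norm (omega : R -> R) (u : V -> R) (Omega : set V) :
  F_functional (fun m => omega `|m|) u Omega = F_functional omega u Omega.
Proof.
apply: eq_integral => z _; rewrite ger0_norm//.
by rewrite divr_ge0// euclid_norm_ge0.
Qed.

End bounded_cube.

Theorem corollary1p5 (R : realType) (omega : R -> R)
    (omega_continuous : {within `[0, +oo[%classic, continuous omega})
    (omega_ge0 : forall m : R, 0 <= m -> 0 <= omega m)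
    (omega_gt0 : forall m : R, 0 < m -> 0 < omega m)
    (omega_int : (\int[@lebesgue_measure R]_(m in `[1%R, +oo[%classic)
                    (omega m / m ^+ 2)%:E = +oo)%E)
    (omega_liminf : (0 < limf_einf (EFin \o omega) (pinfty_nbhs R))%E)
    (d : nat) (d_gt0 : (0 < d)%N)
    (Omega : set 'rV[R]_d) (Omega_connected : connected Omega)
    (Omega_open : open Omega)
    (u : 'rV[R]_d -> R) (u_Linfty : Linfty Omega u)
    (u_nonconstant : ~ essentially_constant Omega u) :
  F_functional omega u Omega = +oo%E.
Proof.
rewrite -F_functional_norm; set w := fun m => omega `|m|.
have w_cont : continuous w by exact: continuous_even_extension.
have w_ge0 m : 0 <= w m by exact: omega_ge0.
have w_gt0 m : 0 < m -> 0 < w m by move=> m0; rewrite /w gtr0_norm// omega_gt0.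
have w_low := liminf_gt0_lower_bound omega_liminf.
have w_int : (\int[@lam R]_(m in `[1%R, +oo[%classic) (w m / m ^+ 2)%:E = +oo)%E.
  rewrite -[RHS]omega_int ge0_integral_lam//.
  - apply: eq_integral => m; rewrite inE/= in_itv/= andbT => m1.
    by rewrite /w ger0_norm// (le_trans ler01).
  - have mw := measurable_weight w_cont.
    apply: measurable_funTS; apply/measurable_EFinP.
    rewrite (_ : (fun m => _) = (fun m : R => w m * `|m|^-1 ^+ 2)); first by measR.
    by apply/funext => m; rewrite exprVn real_normK// num_real.
  - by move=> m _; rewrite lee_fin mulr_ge0// invr_ge0 sqr_ge0.
have [mu [M0 uM0]] := u_Linfty.
have mO := open_measurable_rV Omega_open.
(* The essential bound may be negative when the domain is null. *)
pose M := Num.max 0 M0.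
have M_ge0 : 0 <= M by rewrite le_max lexx.
have uM : {ae (@lebesgue_rV R d), forall x, Omega x -> `|u x| <= M}.
  by apply: filterS uM0 => x h /h ux; rewrite le_max ux orbT.
have [//|Ffin] := eqVneq (F_functional w u Omega) +oo%E.
exfalso; apply: u_nonconstant; apply: connected_ae_constant => // x0 Ox0.
have [r r0 rO] := open_cube Omega_open Ox0.
pose rho := r / 2; have rho0 : 0 < rho by rewrite divr_gt0.
have rE : rho + rho = r by rewrite /rho -splitr.
have [ut [N [mut utM mN N0 utu]]] := borel_version mO mu
  (measurable_cube_borel r x0) (cube_finite r x0) rO uM M_ge0.
rewrite -rE in rO utu.
have Ffin' : (F_functional w u Omega < +oo)%E by rewrite ltey.
have Efin := cube_energy_fin w_cont w_ge0 mO mu mut mN N0 rO utu Ffin'.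
have [c cP] := ae_constant_on_cube w_cont w_ge0 w_gt0 w_low w_int d_gt0 mut utM
  rho0 Efin.
have d1 : 1 <= d%:R :> R by rewrite ler1n.
exists c, (rho / (4 * d%:R)); first by rewrite divr_gt0// mulr_gt0// ltr0n.
have Nae : {ae (@lebesgue_rV R d), forall y, ~ N y}.
  exists (N : set 'rV[R]_d); split => //; first exact: borel_measurable.
  by move=> y /= /contrapT.
apply: filterS2 cP Nae => y yc Ny xy; rewrite -yc// utu//.
apply: le_cube xy; rewrite ler_pdivrMr ?mulr_gt0 ?ltr0n//; nra.
Qed.
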